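(* Let $R=\exp(t^{12})\in\hat{\mathcal A}_2$, and let $\Phi\in\hat{\mathcal A}_3$ satisfy: (symmetry) $\Phi\cdot\Phi^{321}=1$; (non-degeneracy) $\eta_1\Phi=\eta_2\Phi=\eta_3\Phi=1$; (group-like) $\Phi=\exp(\phi)$ for some $\phi\in\hat{\mathcal L}_3$. Let $\lambda$ be the commutative symmetric power series over $\mathbb Q$ in two variables such that $\Phi=1+[a,b]\,\lambda(a,b)$ modulo 1FF. Then the positive hexagon equation $$(\Delta 1)R=\Phi\cdot R^{23}\cdot(\Phi^{-1})^{132}\cdot R^{13}\cdot\Phi^{312}$$ holds modulo 1FF (i.e. in $\mathcal A^{1FF}$) if and only if $$\lambda(a,b)+e^{-b}\lambda(b,c)+e^{a}\lambda(a,c)=\frac{1}{ab}+\frac{e^{-b}}{bc}+\frac{e^{a}}{ac},$$ where this last equation is an equation in the ring of power series in two commuting variables $a,b$, with $c=-(a+b)$.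
   Context: All algebras are over $\mathbb Q$. For $n\ge 2$, $\mathcal A_n$ is the graded unital associative algebra (horizontal chord diagrams on $n$ strands) generated by degree-one elements $t^{ij}=t^{ji}$ ($1\le i\ne j\le n$) with relations $[t^{ij}+t^{jk},t^{ik}]=0$ for distinct $i,j,k$ (4T) and $[t^{ij},t^{kl}]=0$ for distinct $i,j,k,l$; $\hat{\mathcal A}_n$ is its degree completion. $\mathcal L_n$ is the Lie algebra with the same generators and relations (bracket $=$ commutator) and $\hat{\mathcal L}_n\subset\hat{\mathcal A}_n$ its completion. For $n=3$ write $a=t^{12}$, $b=t^{23}$, $c=t^{13}$; then 4T says $a+b+c$ is central. 1FF is the (closed) two-sided ideal generated by all $u(xy-yx)$ with $x,y$ arbitrary and $u$ of degree $\ge1$; $\mathcal A^{1FF}=\hat{\mathcal A}_3/1FF$. Thus, after a factor of degree $\geq 1$, all subsequent factors commute, so $[a,b]\lambda(a,b)$ is well defined for a commutative power series $\lambda$. $\eta_i:\hat{\mathcal A}_n\to\hat{\mathcal A}_{n-1}$ is the algebra map sending $t^{jk}$ to $0$ if $i\in\{j,k\}$, and otherwise deleting strand $i$ and relabeling. $(\Delta1):\hat{\mathcal A}_2\to\hat{\mathcal A}_3$ is the strand-doubling algebra map $t^{12}\mapsto t^{13}+t^{23}$. $R^{23}$, $R^{13}$ denote $R$ with $t^{12}$ replaced by $t^{23}$, $t^{13}$, so $R^{23}=e^b$, $R^{13}=e^c$. For a permutation $xyz$ of $123$, $D^{xyz}$ is the image of $D\in\hat{\mathcal A}_3$ under the algebra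 automorphism induced by relabeling strands $1\mapsto x,2\mapsto y,3\mapsto z$; so $(\cdot)^{321}$: $a\mapsto b,b\mapsto a,c\mapsto c$; $(\cdot)^{132}$: $a\mapsto c,b\mapsto b,c\mapsto a$; $(\cdot)^{312}$: $a\mapsto c,b\mapsto a,c\mapsto b$. It is known that under the three assumptions on $\Phi$ one has $\Phi=1+[a,b]\lambda(a,b)$ modulo 1FF for a unique commutative power series $\lambda$, and that $\lambda$ is symmetric. The right-hand side of the final equation, with $c=-(a+b)$, is a genuine power series in $a,b$. *)

(* Defs.v *)
From HB Require Import structures.
From mathcomp Require Import all_boot all_order all_algebra.
From mathcomp Require Import boolp classical_sets.

Set Implicit Arguments.
Unset Strict Implicit.
Unset Printing Implicit Defensive.

Import GRing.Theory.

Local Open Scope classical_set_scope.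
Local Open Scope ring_scope.
Local Open Scope quotient_scope.

Notation "x %:F" := (@FracField.tofrac _ x) : ring_scope.

(** * Classical inverses *)

Section ClassicalInverse.
Variable R : nzRingType.

Definition classical_unit : pred R :=
  fun x => `[< exists y, y * x = 1 /\ x * y = 1 >].

Definition classical_inv (x : R) : R := xget x [set y | y * x = 1 /\ x * y = 1].

Lemma classical_mulVr : {in classical_unit, left_inverse 1 classical_inv *%R}.
Proof. by move=> x /asboolP h; have [] := xgetPex x h. Qed.

Lemma classical_mulrV : {in classical_unit, right_inverse 1 classical_inv *%R}.
Proof. by move=> x /asboolP h; have [] := xgetPex x h. Qed.

Lemma classical_unitP (x y : R) : y * x = 1 /\ x * y = 1 -> classical_unit x.
Proof. by move=> h; apply/asboolP; exists y. Qed.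

Lemma classical_inv_out : {in [predC classical_unit], classical_inv =1 id}.
Proof.
move=> x /negP hx; rewrite /classical_inv; case: xgetP => // y _ h.
by case: hx; apply/asboolP; exists y.
Qed.

End ClassicalInverse.

(** * Complete filtered rational algebras *)

(* [fil d] is the set of elements all of whose terms have degree at least [d]. *)
HB.mixin Record isCompleteFiltered A of GRing.UnitAlgebra rat A := {
  fil : nat -> set A;
  filT : forall x, fil 0 x;
  fil0 : forall d, fil d 0;
  fil1 : ~ fil 1 1;
  fil_le : forall m n x, (m <= n)%N -> fil n x -> fil m x;
  filB : forall d x y, fil d x -> fil d y -> fil d (x - y);
  filM : forall m n x y, fil m x -> fil n y -> fil (m + n)%N (x * y);
  fil_separated : forall x, (forall d, fil d x) -> x = 0;
  fil_complete : forall u : nat -> A, (forall k, fil k (u k)) ->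
    exists s, forall n, fil n (s - \sum_(k < n) u k)
}.

#[short(type="cfAlgType")]
HB.structure Definition CFAlg :=
  {A of GRing.UnitAlgebra rat A & isCompleteFiltered A}.

Section CFAlgOps.
Variable A : cfAlgType.
Implicit Types (x y : A) (u : nat -> A) (G : set A).

Definition lie x y : A := x * y - y * x.

(* The sum of a series whose [k]-th term lies in [fil k]: it exists by
   [fil_complete] and is unique by [fil_separated]. *)
Definition series_sum u : A :=
  xget 0 [set s | forall n, fil n (s - \sum_(k < n) u k)].

(* Meaningful for [x] in [fil 1]. *)
Definition exp x : A := series_sum (fun k => (k`!%:R)^-1 *: x ^+ k).

Definition fclosure (S : set A) : set A :=
  [set x | forall d, exists2 y, S y & fil d (x - y)].

Definition two_sided_ideal (J : set A) :=
  [/\ J 0, forall x y, J x -> J y -> J (x - y),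
      forall x y, J y -> J (x * y) & forall x y, J x -> J (x * y)].

Definition closed_ideal G : set A := fclosure (smallest two_sided_ideal G).

Definition lie_subalgebra (L : set A) :=
  [/\ L 0, forall x y, L x -> L y -> L (x + y),
      forall (k : rat) x, L x -> L (k *: x) &
      forall x y, L x -> L y -> L (lie x y)].

Definition closed_lie_subalgebra G : set A :=
  fclosure (smallest lie_subalgebra G).

Lemma filN d x : fil d x -> fil d (- x).
Proof. by move=> fx; rewrite -[- x]add0r; apply: filB => //; apply: fil0. Qed.

Lemma filD d x y : fil d x -> fil d y -> fil d (x + y).
Proof. by move=> fx fy; rewrite -[y]opprK; apply: filB => //; apply: filN. Qed.

Lemma fil_sum d (I : Type) (r : seq I) (P : pred I) (F : I -> A) :
  (forall i, P i -> fil d (F i)) -> fil d (\sum_(i <- r | P i) F i).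
Proof. by move=> hF; elim/big_ind: _ => //; [apply: fil0 | apply: filD]. Qed.

Lemma filMl d x y : fil d y -> fil d (x * y).
Proof. by move=> fy; rewrite -[d]add0n; apply: filM => //; apply: filT. Qed.

Lemma filMr d x y : fil d x -> fil d (x * y).
Proof. by move=> fx; rewrite -[d]addn0; apply: filM => //; apply: filT. Qed.

Lemma series_sumP u : (forall k, fil k (u k)) ->
  forall n, fil n (series_sum u - \sum_(k < n) u k).
Proof.
move=> uk; have [s hs] := fil_complete u uk.
exact: (@xgetPex _ 0 [set s | forall n, fil n (s - \sum_(k < n) u k)] (ex_intro _ s hs)).
Qed.

Lemma series_sum_unique u s :
  (forall n, fil n (s - \sum_(k < n) u k)) -> series_sum u = s.
Proof.
move=> hs; apply/eqP; rewrite -subr_eq0; apply/eqP; apply: fil_separated => d.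
have h : [set s' : A | forall n, fil n (s' - \sum_(k < n) u k)] !=set0 by exists s.
have := filB _ _ _ (xgetPex 0 h d) (hs d).
by rewrite opprB addrA subrK.
Qed.

Lemma two_sided_ideal_fil d : two_sided_ideal (fil d : set A).
Proof.
by split; [apply: fil0 | move=> *; apply: filB | move=> *; apply: filMl
          | move=> *; apply: filMr].
Qed.

Lemma two_sided_ideal_smallest G : two_sided_ideal (smallest two_sided_ideal G).
Proof.
split.
- by move=> J [[]].
- move=> x y hx hy J hJ; have [[_ JB _ _] _] := hJ.
  by apply: JB; [apply: hx | apply: hy].
- by move=> x y hy J hJ; have [[_ _ Jl _] _] := hJ; apply: Jl; apply: hy.
- by move=> x y hx J hJ; have [[_ _ _ Jr] _] := hJ; apply: Jr; apply: hx.
Qed.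

Lemma two_sided_ideal_fclosure (J : set A) :
  two_sided_ideal J -> two_sided_ideal (fclosure J).
Proof.
move=> [J0 JB Jl Jr]; split.
- by move=> d; exists 0 => //; rewrite subr0; apply: fil0.
- move=> x y hx hy d; have [x' Jx fx] := hx d; have [y' Jy fy] := hy d.
  exists (x' - y'); first exact: JB.
  by rewrite opprD addrACA -opprD; apply: filB.
- move=> x y hy d; have [y' Jy fy] := hy d; exists (x * y'); first exact: Jl.
  by rewrite -mulrBr; apply: filMl.
- move=> x y hx d; have [x' Jx fx] := hx d; exists (x' * y); first exact: Jr.
  by rewrite -mulrBl; apply: filMr.
Qed.

Lemma two_sided_ideal_closed G : two_sided_ideal (closed_ideal G).
Proof. exact/two_sided_ideal_fclosure/two_sided_ideal_smallest. Qed.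

Lemma sub_closed_ideal G : G `<=` closed_ideal G.
Proof.
move=> x Gx d; exists x; last by rewrite subrr; apply: fil0.
exact: sub_gen_smallest.
Qed.

Lemma closed_ideal_sub G (J : set A) : two_sided_ideal J -> fclosure J `<=` J ->
  G `<=` J -> closed_ideal G `<=` J.
Proof.
move=> iJ cJ sGJ x hx; apply: cJ => d; have [y hy fy] := hx d.
by exists y => //; apply: hy.
Qed.

Lemma fclosure_fil d : fclosure (fil d : set A) `<=` fil d.
Proof.
move=> x /(_ d) [y fy fxy]; rewrite -(subrK y x); exact: filD.
Qed.

Lemma closed_ideal_closed G : fclosure (closed_ideal G) `<=` closed_ideal G.
Proof.
move=> x hx d; have [y /(_ d) [z hz fyz] fxy] := hx d.
exists z => //; rewrite -(subrK y x) -addrA; exact: filD.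
Qed.

End CFAlgOps.

(** * Quotients by closed two-sided ideals *)

Record relators (A : cfAlgType) := Relators {
  relator :> set A;
  relator_fil : relator `<=` fil 1
}.

Definition closed_ideal_pred (A : cfAlgType) (G : relators A) : {pred A} :=
  fun x => `[< closed_ideal G x >].

Section Quotient.
Variables (A : cfAlgType) (G : relators A).

Lemma closed_ideal_predP (x : A) :
  reflect (closed_ideal G x) (x \in closed_ideal_pred G).
Proof. exact: asboolP. Qed.

Lemma closed_ideal_zmod_closed : zmod_closed (closed_ideal_pred G).
Proof.
have [I0 IB _ _] := two_sided_ideal_closed G.
split; first exact/closed_ideal_predP.
by move=> x y /closed_ideal_predP hx /closed_ideal_predP hy;
   apply/closed_ideal_predP; apply: IB.
Qed.
HB.instance Definition _ :=
  GRing.isZmodClosed.Build A (closed_ideal_pred G) closed_ideal_zmod_closed.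

Local Notation I := (closed_ideal_pred G : zmodClosed A).

(* The quotient of [A] by the closed two-sided ideal generated by [G], with the
   filtration induced by that of [A]. *)
Definition cquot := Quotient.quot I.

HB.instance Definition _ := GRing.Zmodule.on cquot.
HB.instance Definition _ : EqQuotient A (Quotient.equiv I) cquot :=
  EqQuotient.on cquot.
HB.instance Definition _ := isZmodQuotient.Build A (Quotient.equiv I) 0 -%R +%R
  cquot (lock _) (@Quotient.pi_opp _ I) (@Quotient.pi_add _ I).

Local Notation pi := (\pi_cquot).

Lemma cquot_eqP (x y : A) : closed_ideal G (x - y) <-> pi x = pi y.
Proof.
split=> [/closed_ideal_predP h|h].
  by apply/eqP; rewrite -(Quotient.idealrBE I x y).
by apply/closed_ideal_predP; rewrite (Quotient.idealrBE I x y); apply/eqP.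
Qed.

Lemma pi0 : pi 0 = 0. Proof. exact: raddf0. Qed.
Lemma piB x y : pi (x - y) = pi x - pi y. Proof. exact: raddfB. Qed.
Lemma piD x y : pi (x + y) = pi x + pi y. Proof. exact: raddfD. Qed.

Let IB := let: And4 _ h _ _ := two_sided_ideal_closed G in h.
Let Il := let: And4 _ _ h _ := two_sided_ideal_closed G in h.
Let Ir := let: And4 _ _ _ h := two_sided_ideal_closed G in h.

Definition cquot_one : cquot := pi 1.
Definition cquot_mul (x y : cquot) : cquot := pi (repr x * repr y).
Definition cquot_scale (k : rat) (x : cquot) : cquot := pi (k *: repr x).

Lemma cquot_repr x : closed_ideal G (repr (pi x) - x).
Proof. by apply/cquot_eqP; rewrite reprK. Qed.

Lemma cquot_piM x y : pi (x * y) = cquot_mul (pi x) (pi y).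
Proof.
apply/esym/cquot_eqP; rewrite -(subrK (x * repr (pi y)) (_ * repr _)) -addrA.
rewrite -mulrBl -mulrBr -[X in _ + X]opprK; apply: IB.
  by apply: Ir; apply: cquot_repr.
by rewrite -mulrN opprB; apply: Il; apply/cquot_eqP; rewrite reprK.
Qed.

Lemma cquot_piZ k x : pi (k *: x) = cquot_scale k (pi x).
Proof.
apply/esym/cquot_eqP; rewrite -scalerBr -[_ - x]mul1r scalerAl.
by apply: Il; apply: cquot_repr.
Qed.

Lemma cquotW (P : cquot -> Prop) : (forall x, P (pi x)) -> forall x, P x.
Proof. by move=> h x; rewrite -[x]reprK. Qed.

Fact cquot_mulA : associative cquot_mul.
Proof.
elim/cquotW=> x; elim/cquotW=> y; elim/cquotW=> z.
by rewrite -!cquot_piM mulrA.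
Qed.

Fact cquot_mul1 : left_id cquot_one cquot_mul.
Proof. by elim/cquotW=> x; rewrite -cquot_piM mul1r. Qed.

Fact cquot_mulr1 : right_id cquot_one cquot_mul.
Proof. by elim/cquotW=> x; rewrite -cquot_piM mulr1. Qed.

Fact cquot_mulDl : left_distributive cquot_mul +%R.
Proof.
elim/cquotW=> x; elim/cquotW=> y; elim/cquotW=> z.
by rewrite -piD -!cquot_piM -piD mulrDl.
Qed.

Fact cquot_mulDr : right_distributive cquot_mul +%R.
Proof.
elim/cquotW=> x; elim/cquotW=> y; elim/cquotW=> z.
by rewrite -piD -!cquot_piM -piD mulrDr.
Qed.

Lemma closed_ideal_fil1 : closed_ideal G `<=` fil 1.
Proof.
apply: closed_ideal_sub; [exact: two_sided_ideal_fil | exact: fclosure_fil |].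
exact: relator_fil.
Qed.

Fact cquot_one_neq0 : cquot_one != 0.
Proof.
apply/eqP; rewrite -pi0 => /cquot_eqP; rewrite subr0 => /closed_ideal_fil1.
exact: fil1.
Qed.

HB.instance Definition _ := GRing.Zmodule_isNzRing.Build cquot
  cquot_mulA cquot_mul1 cquot_mulr1 cquot_mulDl cquot_mulDr cquot_one_neq0.

Lemma piM x y : pi (x * y) = pi x * pi y. Proof. exact: cquot_piM. Qed.
Lemma pi1 : pi 1 = 1. Proof. by []. Qed.

Fact cquot_scaleA a b v :
  cquot_scale a (cquot_scale b v) = cquot_scale (a * b) v.
Proof. by elim/cquotW: v => x; rewrite -!cquot_piZ scalerA. Qed.

Fact cquot_scale1 : left_id 1 cquot_scale.
Proof. by elim/cquotW=> x; rewrite -cquot_piZ scale1r. Qed.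

Fact cquot_scaleDr : right_distributive cquot_scale +%R.
Proof.
move=> k; elim/cquotW=> x; elim/cquotW=> y.
by rewrite -piD -!cquot_piZ -piD scalerDr.
Qed.

Fact cquot_scaleDl v : {morph cquot_scale^~ v : a b / a + b}.
Proof. by elim/cquotW: v => x a b; rewrite -!cquot_piZ -piD scalerDl. Qed.

HB.instance Definition _ := GRing.Zmodule_isLmodule.Build rat cquot
  cquot_scaleA cquot_scale1 cquot_scaleDr cquot_scaleDl.

Lemma piZ k x : pi (k *: x) = k *: pi x. Proof. exact: cquot_piZ. Qed.

Fact cquot_scaleAl (k : rat) (x y : cquot) : k *: (x * y) = (k *: x) * y.
Proof.
by elim/cquotW: x => x; elim/cquotW: y => y; rewrite -piM -!piZ -piM scalerAl.
Qed.
HB.instance Definition _ := GRing.Lmodule_isLalgebra.Build rat cquot cquot_scaleAl.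

Fact cquot_scaleAr (k : rat) (x y : cquot) : k *: (x * y) = x * (k *: y).
Proof.
by elim/cquotW: x => x; elim/cquotW: y => y; rewrite -piM -!piZ -piM scalerAr.
Qed.
HB.instance Definition _ := GRing.Lalgebra_isAlgebra.Build rat cquot cquot_scaleAr.

HB.instance Definition _ := GRing.NzRing_hasMulInverse.Build cquot
  (@classical_mulVr cquot) (@classical_mulrV cquot)
  (@classical_unitP cquot) (@classical_inv_out cquot).

Definition cquot_fil d : set cquot := [set pi x | x in fil d].

Fact cquot_filT x : cquot_fil 0 x.
Proof. by elim/cquotW: x => x; exists x => //; apply: filT. Qed.

Fact cquot_fil0 d : cquot_fil d 0.
Proof. by exists 0; [apply: fil0 | apply: pi0]. Qed.

Fact cquot_fil1 : ~ cquot_fil 1 1.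
Proof.
move=> [x fx /cquot_eqP/closed_ideal_fil1 h]; apply: (@fil1 A).
by have := filB _ _ _ fx h; rewrite subKr.
Qed.

Fact cquot_fil_le m n x : (m <= n)%N -> cquot_fil n x -> cquot_fil m x.
Proof. by move=> lmn [y fy <-]; exists y => //; apply: fil_le fy. Qed.

Fact cquot_filB d x y : cquot_fil d x -> cquot_fil d y -> cquot_fil d (x - y).
Proof.
by move=> [x' fx <-] [y' fy <-]; exists (x' - y'); [apply: filB | apply: piB].
Qed.

Fact cquot_filM m n x y :
  cquot_fil m x -> cquot_fil n y -> cquot_fil (m + n)%N (x * y).
Proof.
by move=> [x' fx <-] [y' fy <-]; exists (x' * y'); [apply: filM | apply: piM].
Qed.

Fact cquot_fil_separated x : (forall d, cquot_fil d x) -> x = 0.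
Proof.
elim/cquotW: x => x hx; rewrite -pi0; apply/cquot_eqP; rewrite subr0.
apply: closed_ideal_closed => d; have [y fy /cquot_eqP hyx] := hx d.
exists (x - y); last by rewrite subKr.
have [I0 _ _ _] := two_sided_ideal_closed G.
by rewrite -opprB -sub0r; apply: IB.
Qed.

Fact cquot_fil_complete (u : nat -> cquot) : (forall k, cquot_fil k (u k)) ->
  exists s, forall n, cquot_fil n (s - \sum_(k < n) u k).
Proof.
move=> hu; pose v k := sval (cid2 (hu k)).
have fv k : fil k (v k) by rewrite /v; case: cid2.
have vu k : pi (v k) = u k by rewrite /v; case: cid2.
have [s hs] := fil_complete v fv; exists (pi s) => n.
exists (s - \sum_(k < n) v k) => //.
by rewrite piB raddf_sum; congr (_ - _); apply: eq_bigr => k _; exact: vu.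
Qed.

HB.instance Definition _ := isCompleteFiltered.Build cquot cquot_filT cquot_fil0
  cquot_fil1 cquot_fil_le cquot_filB cquot_filM cquot_fil_separated
  cquot_fil_complete.

End Quotient.

(** * Noncommutative power series *)

(* [f w] is the coefficient of the word [w]. *)
Record ncseries (X : Type) := NCSeries { nccoef :> seq X -> rat }.

Section NCSeries.
Variable X : Type.
Implicit Types (f g h : ncseries X) (w : seq X).

HB.instance Definition _ := gen_eqMixin (ncseries X).
HB.instance Definition _ := gen_choiceMixin (ncseries X).

Lemma ncseriesP f g : f =1 g -> f = g.
Proof. by case: f g => [f] [g] /= /funext ->. Qed.

Definition ncseries_zero := NCSeries (fun _ : seq X => 0).
Definition ncseries_opp f := NCSeries (fun w => - f w).
Definition ncseries_add f g := NCSeries (fun w => f w + g w).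
Definition ncseries_one := NCSeries (fun w : seq X => (nilp w)%:R).
Definition ncseries_mul f g :=
  NCSeries (fun w => \sum_(i < (size w).+1) f (take i w) * g (drop i w)).
Definition ncseries_scale (k : rat) f := NCSeries (fun w => k * f w).

Fact ncseries_addA : associative ncseries_add.
Proof. by move=> f g h; apply: ncseriesP => w /=; rewrite addrA. Qed.
Fact ncseries_addC : commutative ncseries_add.
Proof. by move=> f g; apply: ncseriesP => w /=; rewrite addrC. Qed.
Fact ncseries_add0 : left_id ncseries_zero ncseries_add.
Proof. by move=> f; apply: ncseriesP => w /=; rewrite add0r. Qed.
Fact ncseries_addN : left_inverse ncseries_zero ncseries_opp ncseries_add.
Proof. by move=> f; apply: ncseriesP => w /=; rewrite addNr. Qed.

HB.instance Definition _ := GRing.isZmodule.Build (ncseries X)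
  ncseries_addA ncseries_addC ncseries_add0 ncseries_addN.

Lemma ncseries_sumE (J : Type) (r : seq J) (P : pred J) (F : J -> ncseries X) w :
  (\sum_(i <- r | P i) F i) w = \sum_(i <- r | P i) F i w.
Proof. by elim/big_rec2: _ => // i y f _ <-. Qed.

Definition ncseries_shift f x := NCSeries (fun w => f (x :: w)).

Lemma ncseries_mul_nil f g : ncseries_mul f g [::] = f [::] * g [::].
Proof. by rewrite /= big_ord_recl big_ord0 addr0. Qed.

Lemma ncseries_mul_cons f g x w : ncseries_mul f g (x :: w) =
  f [::] * g (x :: w) + ncseries_mul (ncseries_shift f x) g w.
Proof. by rewrite /= big_ord_recl. Qed.

Fact ncseries_mulDl : left_distributive ncseries_mul +%R.
Proof.
move=> f g h; apply: ncseriesP => w /=; rewrite -big_split /=.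
by apply: eq_bigr => i _; rewrite mulrDl.
Qed.

Fact ncseries_mulDr : right_distributive ncseries_mul +%R.
Proof.
move=> f g h; apply: ncseriesP => w /=; rewrite -big_split /=.
by apply: eq_bigr => i _; rewrite mulrDr.
Qed.

Lemma ncseries_mulZ k f g w :
  ncseries_mul (ncseries_scale k f) g w = k * ncseries_mul f g w.
Proof. by rewrite /= mulr_sumr; apply: eq_bigr => i _; rewrite mulrA. Qed.

Fact ncseries_mulA : associative ncseries_mul.
Proof.
move=> f g h; apply: ncseriesP => w.
elim: w f => [|x w IHw] f; first by rewrite !ncseries_mul_nil mulrA.
rewrite 2!ncseries_mul_cons IHw ncseries_mul_cons ncseries_mul_nil mulrDr.
rewrite mulrA -addrA; congr (_ + _).
have -> : ncseries_shift (ncseries_mul f g) x =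
    ncseries_scale (f [::]) (ncseries_shift g x) +
    ncseries_mul (ncseries_shift f x) g.
  by apply: ncseriesP => v; rewrite [LHS]ncseries_mul_cons.
by rewrite ncseries_mulDl -ncseries_mulZ.
Qed.

Fact ncseries_mul1 : left_id ncseries_one ncseries_mul.
Proof.
move=> f; apply: ncseriesP => w /=; rewrite big_ord_recl /= take0 drop0 mul1r.
rewrite big1 ?addr0 // => i _; case: w i => [[]//|x w i].
by rewrite /= mul0r.
Qed.

Fact ncseries_mulr1 : right_id ncseries_one ncseries_mul.
Proof.
move=> f; apply: ncseriesP => w /=; rewrite big_ord_recr /= take_size drop_size.
rewrite mulr1 big1 ?add0r // => i _.
by rewrite /nilp size_drop subn_eq0 leqNgt ltn_ord mulr0.
Qed.

Fact ncseries_one_neq0 : ncseries_one != 0.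
Proof. by apply/eqP => /(congr1 (fun f => nccoef f [::])). Qed.

HB.instance Definition _ := GRing.Zmodule_isNzRing.Build (ncseries X)
  ncseries_mulA ncseries_mul1 ncseries_mulr1 ncseries_mulDl ncseries_mulDr
  ncseries_one_neq0.

Fact ncseries_scaleA a b f :
  ncseries_scale a (ncseries_scale b f) = ncseries_scale (a * b) f.
Proof. by apply: ncseriesP => w /=; rewrite mulrA. Qed.
Fact ncseries_scale1 : left_id 1 ncseries_scale.
Proof. by move=> f; apply: ncseriesP => w /=; rewrite mul1r. Qed.
Fact ncseries_scaleDr : right_distributive ncseries_scale +%R.
Proof. by move=> k f g; apply: ncseriesP => w /=; rewrite mulrDr. Qed.
Fact ncseries_scaleDl f : {morph ncseries_scale^~ f : a b / a + b}.
Proof. by move=> a b; apply: ncseriesP => w /=; rewrite mulrDl. Qed.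

HB.instance Definition _ := GRing.Zmodule_isLmodule.Build rat (ncseries X)
  ncseries_scaleA ncseries_scale1 ncseries_scaleDr ncseries_scaleDl.

Fact ncseries_scaleAl (k : rat) f g : k *: (f * g) = (k *: f) * g.
Proof. by apply: ncseriesP => w; rewrite [RHS]ncseries_mulZ. Qed.
HB.instance Definition _ :=
  GRing.Lmodule_isLalgebra.Build rat (ncseries X) ncseries_scaleAl.

Fact ncseries_scaleAr (k : rat) f g : k *: (f * g) = f * (k *: g).
Proof.
apply: ncseriesP => w; rewrite /= mulr_sumr; apply: eq_bigr => i _.
by rewrite mulrCA.
Qed.
HB.instance Definition _ :=
  GRing.Lalgebra_isAlgebra.Build rat (ncseries X) ncseries_scaleAr.

HB.instance Definition _ := GRing.NzRing_hasMulInverse.Build (ncseries X)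
  (@classical_mulVr (ncseries X)) (@classical_mulrV (ncseries X))
  (@classical_unitP (ncseries X)) (@classical_inv_out (ncseries X)).

Definition ncseries_fil d : set (ncseries X) :=
  [set f | forall w, (size w < d)%N -> f w = 0].

Fact ncseries_filT f : ncseries_fil 0 f. Proof. by []. Qed.
Fact ncseries_fil0 d : ncseries_fil d 0. Proof. by []. Qed.
Fact ncseries_fil1 : ~ ncseries_fil 1 1. Proof. by move=> /(_ [::] isT). Qed.

Fact ncseries_fil_le m n f :
  (m <= n)%N -> ncseries_fil n f -> ncseries_fil m f.
Proof. by move=> le_mn hf w hw; apply: hf; apply: leq_trans le_mn. Qed.

Fact ncseries_filB d f g :
  ncseries_fil d f -> ncseries_fil d g -> ncseries_fil d (f - g).
Proof. by move=> hf hg w hw; rewrite /= hf // hg // subr0. Qed.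

Fact ncseries_filM m n f g :
  ncseries_fil m f -> ncseries_fil n g -> ncseries_fil (m + n)%N (f * g).
Proof.
move=> hf hg w hw; rewrite /= big1 // => i _.
have le_iw : (i <= size w)%N by rewrite -ltnS.
have [lt_im|le_mi] := ltnP i m.
  by rewrite hf ?mul0r // size_takel.
rewrite hg ?mulr0 // size_drop ltn_subLR //.
by apply: leq_trans hw _; rewrite leq_add2r.
Qed.

Fact ncseries_fil_separated f : (forall d, ncseries_fil d f) -> f = 0.
Proof. by move=> hf; apply: ncseriesP => w; apply: (hf (size w).+1). Qed.

Fact ncseries_fil_complete (u : nat -> ncseries X) :
  (forall k, ncseries_fil k (u k)) ->
  exists s, forall n, ncseries_fil n (s - \sum_(k < n) u k).
Proof.
move=> hu; exists (NCSeries (fun w => \sum_(k < (size w).+1) u k w)) => n w hw.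
rewrite /= ncseries_sumE (big_ord_widen n (fun k => u k w) hw) big_mkcond /=.
apply/eqP; rewrite subr_eq0; apply/eqP; apply: eq_bigr => k _.
by case: ltnP => // le_wk; rewrite hu.
Qed.

HB.instance Definition _ := isCompleteFiltered.Build (ncseries X) ncseries_filT
  ncseries_fil0 ncseries_fil1 ncseries_fil_le ncseries_filB ncseries_filM
  ncseries_fil_separated ncseries_fil_complete.

End NCSeries.

Definition letter (X : eqType) (x : X) : ncseries X :=
  NCSeries (fun w => (w == [:: x])%:R).

Lemma letter_fil (X : eqType) (x : X) : fil 1 (letter x).
Proof. by case=> [|y w]. Qed.

(* The value of the noncommutative power series [f] at the family [g] of
   elements of [fil 1]. *)
Definition nceval (X : finType) (B : cfAlgType) (g : X -> B) (f : ncseries X) : B :=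
  series_sum (fun d => \sum_(w : d.-tuple X) f w *: \prod_(x <- w) g x).

Section NCEval.
Variables (X : finType) (B : cfAlgType) (g : X -> B).
Hypothesis g_fil : forall x, fil 1 (g x).
Implicit Types f h : ncseries X.

Let T f d : B := \sum_(w : d.-tuple X) f w *: \prod_(x <- w) g x.

Let T0 f : T f 0 = f [::] *: 1.
Proof.
rewrite /T (bigD1 [tuple]) //= big_nil big1 ?addr0 // => w /eqP[].
by rewrite tuple0.
Qed.

Let TS f d : T f d.+1 = \sum_x g x * T (ncseries_shift f x) d.
Proof.
under [RHS]eq_bigr => x _ do rewrite mulr_sumr.
rewrite (pair_bigA _ (fun x (w : d.-tuple X) =>
  g x * (ncseries_shift f x w *: \prod_(y <- w) g y))) /=.
rewrite /T (reindex (fun p : X * d.-tuple X => [tuple of p.1 :: p.2])) /=.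
  by apply: eq_bigr => -[x w] _; rewrite big_cons scalerAr.
exists (fun w : d.+1.-tuple X => (thead w, [tuple of behead w])) => [[x w]|w] _ /=.
  by rewrite theadE; congr (_, _); apply: val_inj.
by rewrite -tuple_eta.
Qed.

Let TD f h d : T (f + h) d = T f d + T h d.
Proof. by rewrite -big_split /=; apply: eq_bigr => w _; rewrite scalerDl. Qed.

Let TZ k f d : T (k *: f) d = k *: T f d.
Proof. by rewrite scaler_sumr; apply: eq_bigr => w _; rewrite scalerA. Qed.

Let T_fil f d : fil d (T f d).
Proof.
elim: d f => [|d IHd] f; first exact: filT.
rewrite TS; apply: fil_sum => x _; rewrite -add1n; exact: filM.
Qed.

Let TM f h d : T (f * h) d = \sum_(i < d.+1) T f i * T h (d - i)%N.
Proof.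
elim: d f => [|d IHd] f.
  rewrite big_ord_recl big_ord0 addr0 !T0 -scalerAl mul1r scalerA.
  by rewrite [X in X *: _]ncseries_mul_nil.
rewrite big_ord_recl subn0 T0 -scalerAl mul1r 2!TS scaler_sumr.
under [X in _ + X]eq_bigr => i _ do rewrite TS mulr_suml.
rewrite exchange_big -big_split; apply: eq_bigr => x _ /=.
have -> : ncseries_shift (f * h) x =
    f [::] *: ncseries_shift h x + ncseries_shift f x * h.
  by apply: ncseriesP => w; rewrite [LHS]ncseries_mul_cons.
rewrite TD TZ mulrDr scalerAr IHd mulr_sumr; congr (_ + _).
by apply: eq_bigr => i _; rewrite mulrA.
Qed.

Let sumT f n := \sum_(d < n) T f d.

Let ncevalP f n : fil n (nceval g f - sumT f n).
Proof. by apply: series_sumP => d; apply: T_fil. Qed.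

Let ncevalE f s : (forall n, fil n (s - sumT f n)) -> nceval g f = s.
Proof. exact: series_sum_unique. Qed.

Lemma ncevalD f h : nceval g (f + h) = nceval g f + nceval g h.
Proof.
apply: ncevalE => n; rewrite /sumT.
under eq_bigr => d _ do rewrite TD.
by rewrite big_split /= opprD addrACA; apply: filD; apply: ncevalP.
Qed.

Lemma ncevalZ k f : nceval g (k *: f) = k *: nceval g f.
Proof.
apply: ncevalE => n; rewrite /sumT.
under eq_bigr => d _ do rewrite TZ.
by rewrite -scaler_sumr -scalerBr -mulr_algl; apply: filMl; apply: ncevalP.
Qed.

Lemma ncevalB f h : nceval g (f - h) = nceval g f - nceval g h.
Proof. by rewrite ncevalD -scaleN1r ncevalZ scaleN1r. Qed.

Lemma nceval1 : nceval g 1 = 1.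
Proof.
apply: ncevalE => -[|n]; first exact: filT.
rewrite /sumT.
rewrite big_ord_recl big1 => [|d _] /=.
  by rewrite T0 scale1r addr0 subrr; apply: fil0.
by rewrite /T big1 // => w _; rewrite (tuple_eta w) scale0r.
Qed.

Lemma nceval_letter x : nceval g (letter x) = g x.
Proof.
apply: ncevalE => -[|[|n]]; rewrite /sumT; first exact: filT.
  rewrite big_ord_recl big_ord0 addr0 T0 scale0r subr0; exact: g_fil.
rewrite 2!big_ord_recl T0 scale0r add0r big1 => [|d _] /=.
  rewrite /T (bigD1 [tuple x]) //= eqxx scale1r big_seq1 big1 ?addr0 => [|w hw].
    by rewrite subrr; apply: fil0.
  rewrite /= (_ : (_ == _) = false) ?scale0r //; apply: contra_neqF hw => /eqP hw.
  exact: val_inj.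
rewrite /T big1 // => w _; rewrite /= (_ : (_ == _) = false) ?scale0r //.
by apply/eqP => /(congr1 size); rewrite size_tuple.
Qed.

Lemma ncevalM f h : nceval g (f * h) = nceval g f * nceval g h.
Proof.
apply: ncevalE => n; rewrite /sumT.
have h1 : fil n (nceval g f * nceval g h - sumT f n * sumT h n).
  rewrite -(subrK (sumT f n * nceval g h) (_ * nceval g h)) -addrA.
  rewrite -mulrBl -mulrBr.
  by apply: filD; [apply: filMr | apply: filMl]; apply: ncevalP.
rewrite -(subrK (sumT f n * sumT h n) (_ * nceval g h)) -addrA.
apply: filD => //; rewrite {h1}.
under eq_bigr => d _ do rewrite TM.
have -> : sumT f n * sumT h n = \sum_(i < n) \sum_(j < n) T f i * T h j.
  by rewrite /sumT mulr_suml; apply: eq_bigr => i _; rewrite mulr_sumr.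
have -> : \sum_(d < n) \sum_(i < d.+1) T f i * T h (d - i)%N =
    \sum_(i < n) \sum_(j < n | (i + j < n)%N) T f i * T h j.
  pose F i j := T f i * T h j.
  transitivity (\sum_(d < n) \sum_(i < n | (i <= d)%N) F i (d - i)%N).
    by apply: eq_bigr => d _; rewrite (big_ord_widen_cond n xpredT (fun i => F i (d - i)%N)) //.
  rewrite (exchange_big_dep xpredT) //=; apply: eq_bigr => i _.
  rewrite -(big_mkord (fun d => i <= d)%N (fun d => F i (d - i)%N)).
  rewrite -(big_mkord (fun j => i + j < n)%N (fun j => F i j)).
  rewrite (@big_cat_nat _ _ _ i) //=; last exact: ltnW.
  rewrite [X in X + _]big_nat_cond big1 ?add0r => [|d /andP[]]; last first.
    by move=> /andP[_ lt_di]; rewrite leqNgt lt_di.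
  rewrite -{1}[i : nat]add0n big_addn.
  rewrite [RHS](@big_cat_nat _ _ _ (n - i)) ?leq_subr //=.
  rewrite [X in _ = _ + X]big_nat_cond [X in _ = _ + X]big1 ?addr0; last first.
    by move=> j /andP[/andP[le_j _]]; rewrite -ltn_subRL ltnNge le_j.
  rewrite big_nat_cond [RHS]big_nat_cond; apply: eq_big => j.
    by rewrite leq_addl andbT /= -ltn_subRL andbb.
  by rewrite addnK.
rewrite -sumrB; apply: fil_sum => i _.
rewrite (bigID (fun j : 'I_n => (i + j < n)%N)) /= addrC addrK.
apply: fil_sum => j; rewrite -leqNgt => le_n.
by apply: fil_le le_n _; apply: filM.
Qed.

Lemma nceval_fil d f : fil d f -> fil d (nceval g f).
Proof.
move=> hf; have := ncevalP f d; rewrite /sumT big1 ?subr0 // => i _.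
by rewrite /T big1 // => w _; rewrite hf ?scale0r // size_tuple.
Qed.

Lemma nceval_closed_ideal (G : set (ncseries X)) :
  (forall r, G r -> nceval g r = 0) ->
  forall f, closed_ideal G f -> nceval g f = 0.
Proof.
move=> G0; apply: (closed_ideal_sub (J := [set f | nceval g f = 0])) => //.
  have E0 : nceval g 0 = 0 by rewrite -[0 in LHS](subrr 0) ncevalB subrr.
  split=> //= [f h hf hh|f h hh|f h hf]; first by rewrite ncevalB hf hh subrr.
    by rewrite ncevalM hh mulr0.
  by rewrite ncevalM hf mul0r.
move=> f hf; apply: fil_separated => d; have [h /= h0 fh] := hf d.
by rewrite -[nceval g f]subr0 -h0 -ncevalB; apply: nceval_fil.
Qed.

End NCEval.

(** * Commutative power series *)

Record pseries (R : Type) := PSeries { pcoef :> nat -> R }.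

Section PSeries.
Variable R : comNzRingType.
Implicit Types f g h : pseries R.

HB.instance Definition _ := gen_eqMixin (pseries R).
HB.instance Definition _ := gen_choiceMixin (pseries R).

Lemma pseriesP f g : f =1 g -> f = g.
Proof. by case: f g => [f] [g] /= /funext ->. Qed.

Definition pseries_zero := PSeries (fun _ => 0 : R).
Definition pseries_opp f := PSeries (fun n => - f n).
Definition pseries_add f g := PSeries (fun n => f n + g n).
Definition pseries_const (c : R) := PSeries (fun n => if n == 0%N then c else 0).
Definition pseries_X : pseries R := PSeries (fun n => (n == 1%N)%:R).
Definition pseries_mul f g :=
  PSeries (fun n => \sum_(i < n.+1) f i * g (n - i)%N).

Fact pseries_addA : associative pseries_add.
Proof. by move=> f g h; apply: pseriesP => n /=; rewrite addrA. Qed.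
Fact pseries_addC : commutative pseries_add.
Proof. by move=> f g; apply: pseriesP => n /=; rewrite addrC. Qed.
Fact pseries_add0 : left_id pseries_zero pseries_add.
Proof. by move=> f; apply: pseriesP => n /=; rewrite add0r. Qed.
Fact pseries_addN : left_inverse pseries_zero pseries_opp pseries_add.
Proof. by move=> f; apply: pseriesP => n /=; rewrite addNr. Qed.

HB.instance Definition _ := GRing.isZmodule.Build (pseries R)
  pseries_addA pseries_addC pseries_add0 pseries_addN.

Lemma pseries_sumE (J : Type) (r : seq J) (P : pred J) (F : J -> pseries R) n :
  (\sum_(i <- r | P i) F i) n = \sum_(i <- r | P i) F i n.
Proof. by elim/big_rec2: _ => // i y f _ <-. Qed.

Let trunc n f : {poly R} := \poly_(i < n) f i.

Let pseries_mulE m n f g :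
  (n < m)%N -> pseries_mul f g n = (trunc m f * trunc m g)`_n.
Proof.
move=> lt_nm; rewrite coefM; apply: eq_bigr => i _; rewrite !coef_poly.
by rewrite !(leq_ltn_trans _ lt_nm) ?leq_subr // -ltnS.
Qed.

Fact pseries_mulA : associative pseries_mul.
Proof.
move=> f g h; apply: pseriesP => n; rewrite !(@pseries_mulE n.+1) //.
have E f' g' i : (i < n.+1)%N ->
    (trunc n.+1 (pseries_mul f' g'))`_i = (trunc n.+1 f' * trunc n.+1 g')`_i.
  by move=> lt_in; rewrite coef_poly lt_in (@pseries_mulE n.+1).
have -> : (trunc n.+1 f * trunc n.+1 (pseries_mul g h))`_n =
    (trunc n.+1 f * (trunc n.+1 g * trunc n.+1 h))`_n.
  by rewrite !coefM; apply: eq_bigr => i _; rewrite E // ltnS leq_subr.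
rewrite mulrA [LHS]coefM [RHS]coefM.
by apply: eq_bigr => i _; rewrite E.
Qed.

Fact pseries_mulC : commutative pseries_mul.
Proof.
by move=> f g; apply: pseriesP => n; rewrite !(@pseries_mulE n.+1) // mulrC.
Qed.

Fact pseries_mul1 : left_id (pseries_const 1) pseries_mul.
Proof.
move=> f; apply: pseriesP => n /=; rewrite big_ord_recl /= subn0 mul1r.
by rewrite big1 ?addr0 // => i _; rewrite mul0r.
Qed.

Fact pseries_mulDl : left_distributive pseries_mul +%R.
Proof.
move=> f g h; apply: pseriesP => n /=; rewrite -big_split /=.
by apply: eq_bigr => i _; rewrite mulrDl.
Qed.

Fact pseries_one_neq0 : pseries_const 1 != 0.
Proof.
by apply/eqP => /(congr1 (fun f => pcoef f 0%N)) /= /eqP; rewrite oner_eq0.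
Qed.

HB.instance Definition _ := GRing.Zmodule_isComNzRing.Build (pseries R)
  pseries_mulA pseries_mulC pseries_mul1 pseries_mulDl pseries_one_neq0.

HB.instance Definition _ := GRing.NzRing_hasMulInverse.Build (pseries R)
  (@classical_mulVr (pseries R)) (@classical_mulrV (pseries R))
  (@classical_unitP (pseries R)) (@classical_inv_out (pseries R)).

End PSeries.

Section PSeriesDomain.
Variable R : idomainType.

Lemma pseries_order (f : pseries R) :
  f != 0 -> exists2 m, f m != 0 & forall i, (i < m)%N -> f i = 0.
Proof.
move=> /eqP f0.
have [n fn] : exists n, f n != 0.
  apply: contrapT => h; apply: f0; apply: pseriesP => n; apply/eqP.
  by apply: contrapT => fn; apply: h; exists n; apply/negP.
have exf : exists n, f n != 0 by exists n.
exists (ex_minn exf); case: ex_minnP => // m _ hm i lt_im.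
by apply/eqP; apply: contraTT lt_im; rewrite -leqNgt; apply: hm.
Qed.

Fact pseries_integral : GRing.integral_domain_axiom (pseries R).
Proof.
move=> f g fg0; case: (eqVneq f 0) => //= /pseries_order [m fm hm].
case: (eqVneq g 0) => //= /pseries_order [n gn hn].
have /eqP : (f * g) (m + n)%N = 0 by rewrite fg0.
have lt_m : (m < (m + n).+1)%N by rewrite ltnS leq_addr.
rewrite /= (bigD1 (Ordinal lt_m)) //= addKn big1 ?addr0.
  by rewrite mulf_eq0 (negbTE fm) (negbTE gn).
move=> i; rewrite -val_eqE /= neq_ltn => /orP[/hm-> | lt_mi]; first exact: mul0r.
by rewrite hn ?mulr0 // ltn_subLR ?ltn_add2r // -ltnS.
Qed.

HB.instance Definition _ :=
  GRing.ComUnitRing_isIntegral.Build (pseries R) pseries_integral.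

End PSeriesDomain.

(* The ring of power series in two commuting variables [varA] and [varB]; the
   coefficient of [varA ^+ i * varB ^+ j] in [f] is [f i j]. *)
Definition pseries2 := pseries (pseries rat).

HB.instance Definition _ := GRing.IntegralDomain.on pseries2.

Definition varA : pseries2 := pseries_X (pseries rat).
Definition varB : pseries2 := pseries_const (pseries_X rat).

Section PSeries2.
Implicit Types f g : pseries2.

Definition pseries2_scale (k : rat) f : pseries2 :=
  PSeries (fun i => PSeries (fun j => k * f i j)).

Lemma pseries2P f g : (forall i j, f i j = g i j) -> f = g.
Proof. by move=> h; apply: pseriesP => i; apply: pseriesP. Qed.

Lemma pseries2_mulE f g i j : (f * g) i j =
  \sum_(p < i.+1) \sum_(q < j.+1) f p q * g (i - p)%N (j - q)%N.
Proof. by rewrite [LHS]pseries_sumE. Qed.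

Fact pseries2_scaleA a b f :
  pseries2_scale a (pseries2_scale b f) = pseries2_scale (a * b) f.
Proof. by apply: pseries2P => i j /=; rewrite mulrA. Qed.
Fact pseries2_scale1 : left_id 1 pseries2_scale.
Proof. by move=> f; apply: pseries2P => i j /=; rewrite mul1r. Qed.
Fact pseries2_scaleDr : right_distributive pseries2_scale +%R.
Proof. by move=> k f g; apply: pseries2P => i j /=; rewrite mulrDr. Qed.
Fact pseries2_scaleDl f : {morph pseries2_scale^~ f : a b / a + b}.
Proof. by move=> a b; apply: pseries2P => i j /=; rewrite mulrDl. Qed.

HB.instance Definition _ := GRing.Zmodule_isLmodule.Build rat pseries2
  pseries2_scaleA pseries2_scale1 pseries2_scaleDr pseries2_scaleDl.

Fact pseries2_scaleAl (k : rat) f g : k *: (f * g) = (k *: f) * g.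
Proof.
apply: pseries2P => i j; rewrite [RHS]pseries2_mulE.
rewrite [LHS](_ : _ = k * (f * g) i j) // pseries2_mulE mulr_sumr.
apply: eq_bigr => p _; rewrite mulr_sumr.
by apply: eq_bigr => q _; rewrite mulrA.
Qed.
HB.instance Definition _ :=
  GRing.Lmodule_isLalgebra.Build rat pseries2 pseries2_scaleAl.

Fact pseries2_scaleAr (k : rat) f g : k *: (f * g) = f * (k *: g).
Proof. by rewrite mulrC scalerAl mulrC. Qed.
HB.instance Definition _ :=
  GRing.Lalgebra_isAlgebra.Build rat pseries2 pseries2_scaleAr.

Definition pseries2_fil d : set pseries2 :=
  [set f : pseries2 | forall i j, (i + j < d)%N -> f i j = 0].

Fact pseries2_filT f : pseries2_fil 0 f. Proof. by []. Qed.
Fact pseries2_fil0 d : pseries2_fil d 0. Proof. by []. Qed.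
Fact pseries2_fil1 : ~ pseries2_fil 1 1. Proof. by move=> /(_ 0%N 0%N isT). Qed.

Fact pseries2_fil_le m n f :
  (m <= n)%N -> pseries2_fil n f -> pseries2_fil m f.
Proof. by move=> le_mn hf i j h; apply: hf; apply: leq_trans le_mn. Qed.

Fact pseries2_filB d f g :
  pseries2_fil d f -> pseries2_fil d g -> pseries2_fil d (f - g).
Proof. by move=> hf hg i j h; rewrite /= hf // hg // subr0. Qed.

Fact pseries2_filM m n f g :
  pseries2_fil m f -> pseries2_fil n g -> pseries2_fil (m + n)%N (f * g).
Proof.
move=> hf hg i j h; rewrite pseries2_mulE big1 // => p _; rewrite big1 // => q _.
have le_pi : (p <= i)%N by rewrite -ltnS.
have le_qj : (q <= j)%N by rewrite -ltnS.
have [lt_m|le_m] := ltnP (p + q) m; first by rewrite hf ?mul0r.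
rewrite hg ?mulr0 // -(ltn_add2l (p + q)) addnACA !subnKC //.
by apply: leq_trans h _; rewrite leq_add2r.
Qed.

Fact pseries2_fil_separated f : (forall d, pseries2_fil d f) -> f = 0.
Proof. by move=> hf; apply: pseries2P => i j; apply: (hf (i + j).+1). Qed.

Fact pseries2_fil_complete (u : nat -> pseries2) :
  (forall k, pseries2_fil k (u k)) ->
  exists s, forall n, pseries2_fil n (s - \sum_(k < n) u k).
Proof.
move=> hu.
exists (PSeries (fun i => PSeries (fun j => \sum_(k < (i + j).+1) u k i j))).
move=> n i j h; rewrite /= !pseries_sumE.
rewrite (big_ord_widen n (fun k => u k i j) h) big_mkcond /=.
apply/eqP; rewrite subr_eq0; apply/eqP; apply: eq_bigr => k _.
by case: ltnP => // le_k; rewrite hu.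
Qed.

HB.instance Definition _ := isCompleteFiltered.Build pseries2 pseries2_filT
  pseries2_fil0 pseries2_fil1 pseries2_fil_le pseries2_filB pseries2_filM
  pseries2_fil_separated pseries2_fil_complete.

End PSeries2.

(* The value of [lam] at [x] and [y] in [fil 1]; when [x] and [y] do not commute
   the powers of [x] are put on the left. *)
Definition eval2 (B : cfAlgType) (lam : pseries2) (x y : B) : B :=
  series_sum (fun d =>
    \sum_(i < d.+1) lam i (d - i)%N *: (x ^+ i * y ^+ (d - i)%N)).

(** * Horizontal chord diagrams *)

Notation chord_word n := (ncseries ('I_n * 'I_n)%type).

(* The generators are indexed by all ordered pairs of strands; those on the
   diagonal do not occur in the chord diagrams and are set to zero. *)
Inductive chord_relation n : set (chord_word n) :=
| chord_diag i : chord_relation (letter (i, i))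
| chord_sym i j : chord_relation (letter (i, j) - letter (j, i))
| chord_4T i j k : uniq [:: i; j; k] ->
    chord_relation (lie (letter (i, j) + letter (j, k)) (letter (i, k)))
| chord_locality i j k l : uniq [:: i; j; k; l] ->
    chord_relation (lie (letter (i, j)) (letter (k, l))).

Lemma chord_relation_fil n : @chord_relation n `<=` fil 1.
Proof.
move=> f [i|i j|i j k _|i j k l _].
- exact: letter_fil.
- by apply: filB; apply: letter_fil.
- by apply: filB; apply: filMr; [apply: filD|]; apply: letter_fil.
- by apply: filB; apply: filMr; apply: letter_fil.
Qed.

(* The degree completion of the algebra of horizontal chord diagrams on [n]
   strands: as the relations are homogeneous, it is the quotient of the algebra
   of noncommutative power series by the closed ideal they generate. *)
Definition Ahat n := cquot (Relators (@chord_relation_fil n)).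
HB.instance Definition _ n := CFAlg.on (Ahat n).
HB.instance Definition _ n := EqQuotient.on (Ahat n).

Definition t n (i j : 'I_n) : Ahat n := \pi_(Ahat n) (letter (i, j)).

(* The Lie algebra with the same presentation embeds in the algebra, which is its
   universal enveloping algebra, as the Lie subalgebra generated by the chords. *)
Definition Lhat n : set (Ahat n) :=
  closed_lie_subalgebra [set t i j | i in setT & j in setT].

(* The continuous algebra map sending [t i j] to [g (i, j)], for [g] satisfying
   [chord_compatible] below. *)
Definition Ahat_map n (B : cfAlgType) (g : 'I_n * 'I_n -> B) (x : Ahat n) : B :=
  nceval g (repr x).

Variant chord_compatible n (B : cfAlgType) (g : 'I_n * 'I_n -> B) : Prop :=
  ChordCompatible of
    (forall p, fil 1 (g p)) &
    (forall i, g (i, i) = 0) &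
    (forall i j, g (i, j) = g (j, i)) &
    (forall i j k, uniq [:: i; j; k] ->
       lie (g (i, j) + g (j, k)) (g (i, k)) = 0) &
    (forall i j k l, uniq [:: i; j; k; l] -> lie (g (i, j)) (g (k, l)) = 0).

Section AhatMap.
Variables (n : nat) (B : cfAlgType) (g : 'I_n * 'I_n -> B).
Hypothesis g_compat : chord_compatible g.

Let g_fil : forall p, fil 1 (g p). Proof. by case: g_compat. Qed.

Lemma Ahat_map_pi f : Ahat_map g (\pi_(Ahat n) f) = nceval g f.
Proof.
apply/eqP; rewrite -subr_eq0 -ncevalB //; apply/eqP.
apply: (@nceval_closed_ideal _ _ _ g_fil (@chord_relation n)); last first.
  exact: (@cquot_repr _ (Relators (@chord_relation_fil n))).
have [_ g_diag g_sym g_4T g_locality] := g_compat.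
move=> _ [i|i j|i j k hu|i j k l hu].
- by rewrite nceval_letter.
- by rewrite ncevalB // !nceval_letter // g_sym subrr.
- by rewrite /lie ncevalB // !ncevalM // ncevalD // !nceval_letter //; apply: g_4T.
- by rewrite /lie ncevalB // !ncevalM // !nceval_letter //; apply: g_locality.
Qed.

Lemma Ahat_map_t i j : Ahat_map g (t i j) = g (i, j).
Proof. by rewrite Ahat_map_pi nceval_letter. Qed.

Lemma Ahat_map1 : Ahat_map g 1 = 1.
Proof. by rewrite (_ : 1 = \pi_(Ahat n) 1) // Ahat_map_pi nceval1. Qed.

Lemma Ahat_mapD : {morph Ahat_map g : x y / x + y}.
Proof.
elim/cquotW=> x; elim/cquotW=> y.
by rewrite -piD !Ahat_map_pi ncevalD.
Qed.

Lemma Ahat_mapZ k : {morph Ahat_map g : x / k *: x}.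
Proof. by elim/cquotW=> x; rewrite -piZ !Ahat_map_pi ncevalZ. Qed.

Lemma Ahat_mapM : {morph Ahat_map g : x y / x * y}.
Proof.
elim/cquotW=> x; elim/cquotW=> y.
by rewrite -piM !Ahat_map_pi ncevalM.
Qed.

Lemma Ahat_map_fil d x : fil d x -> fil d (Ahat_map g x).
Proof. by move=> [f hf <-]; rewrite Ahat_map_pi; apply: nceval_fil. Qed.

End AhatMap.

Lemma t_compat n : chord_compatible (fun p : 'I_n * 'I_n => t p.1 p.2).
Proof.
have rel r : chord_relation r -> \pi_(Ahat n) r = 0.
  move=> hr; rewrite -pi0; apply/cquot_eqP; rewrite subr0.
  exact: sub_closed_ideal.
split=> /= [p|i|i j|i j k hu|i j k l hu].
- by exists (letter p); [apply: letter_fil | case: p].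
- by apply: rel; apply: chord_diag.
- by apply/eqP; rewrite -subr_eq0 -piB; apply/eqP/rel; apply: chord_sym.
- by rewrite /lie -piD -!piM -piB; apply: rel; apply: chord_4T.
- by rewrite /lie -!piM -piB; apply: rel; apply: chord_locality.
Qed.

(* [unlift i j] is [None] if [j = i], and otherwise the position of the strand
   [j] after deletion of the strand [i]. *)
Definition eta_gen n (i : 'I_n.+1) (jk : 'I_n.+1 * 'I_n.+1) : Ahat n :=
  match unlift i jk.1, unlift i jk.2 with
  | Some j, Some k => t j k
  | _, _ => 0
  end.

Definition eta n (i : 'I_n.+1) : Ahat n.+1 -> Ahat n := Ahat_map (eta_gen i).

Lemma eta_compat n (i : 'I_n.+1) : chord_compatible (eta_gen i).
Proof.
have [t_fil t_diag t_sym t_4T t_loc] := t_compat n.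
have lie0r x : lie x (0 : Ahat n) = 0 by rewrite /lie mulr0 mul0r subrr.
have lie0l x : lie (0 : Ahat n) x = 0 by rewrite /lie mulr0 mul0r subrr.
have xx (x : Ahat n) : lie x x = 0 by rewrite /lie subrr.
split=> [[p q]|p|p q|p q r|p q r s]; rewrite /eta_gen /=.
- case: (unlift i p) => [p'|]; last exact: fil0.
  case: (unlift i q) => [q'|]; last exact: fil0.
  exact: (t_fil (p', q')).
- by case: (unlift i p) => // p'; apply: t_diag.
- by case: (unlift i p) => [p'|]; case: (unlift i q) => // q'; apply: t_sym.
- case: (unliftP i p) => [p'|] -> //; case: (unliftP i q) => [q'|] -> //;
    case: (unliftP i r) => [r'|] -> //;
    rewrite ?lie0r ?lie0l ?addr0 ?add0r ?lie0r ?lie0l // => hu.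
  apply: t_4T; move: hu; rewrite /= !inE !(inj_eq (@lift_inj _ i)).
  by [].
- case: (unliftP i p) => [p'|] -> //; case: (unliftP i q) => [q'|] -> //;
    case: (unliftP i r) => [r'|] -> //; case: (unliftP i s) => [s'|] -> //;
    rewrite ?lie0r ?lie0l // => hu.
  apply: t_loc; move: hu; rewrite /= !inE !(inj_eq (@lift_inj _ i)).
  by [].
Qed.

(* Puts the strands of [x], in order, on the distinct strands listed in [s];
   when [m = n] this is the relabeling of the [i]-th strand as the [i]-th entry
   of [s]. *)
Definition on_strands m n (s : m.-tuple 'I_n) : Ahat m -> Ahat n :=
  Ahat_map (fun ij => t (tnth s ij.1) (tnth s ij.2)).

Lemma on_strands_compat m n (s : m.-tuple 'I_n) : uniq s ->
  chord_compatible (fun ij => t (tnth s ij.1) (tnth s ij.2)).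
Proof.
move=> /tuple_uniqP s_inj; have [t_fil t_diag t_sym t_4T t_loc] := t_compat n.
split=> /= [p|i|i j|i j k hu|i j k l hu].
- exact: (t_fil (_, _)).
- exact: t_diag.
- exact: t_sym.
- apply: t_4T; exact: (etrans (map_inj_uniq s_inj [:: i; j; k]) hu).
- apply: t_loc; exact: (etrans (map_inj_uniq s_inj [:: i; j; k; l]) hu).
Qed.

Definition s1 : 'I_3 := @Ordinal 3 0 isT.
Definition s2 : 'I_3 := @Ordinal 3 1 isT.
Definition s3 : 'I_3 := @Ordinal 3 2 isT.

Definition Delta1_gen (ij : 'I_2 * 'I_2) : Ahat 3 :=
  if ij.1 == ij.2 then 0 else t s1 s3 + t s2 s3.

Definition Delta1 : Ahat 2 -> Ahat 3 := Ahat_map Delta1_gen.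

Lemma Delta1_compat : chord_compatible Delta1_gen.
Proof.
have [t_fil _ _ _ _] := t_compat 3.
split=> [[i j]|i|i j|i j k hu|i j k l hu]; rewrite /Delta1_gen /=.
- case: eqP => _; first exact: fil0.
  by apply: filD; [apply: (t_fil (s1, s3)) | apply: (t_fil (s2, s3))].
- by rewrite eqxx.
- by rewrite eq_sym.
- by have := max_card [in [:: i; j; k]]; rewrite (card_uniqP hu) card_ord.
- by have := max_card [in [:: i; j; k; l]]; rewrite (card_uniqP hu) card_ord.
Qed.

Definition t12 : Ahat 2 := t ord0 ord_max.

Definition chord_a : Ahat 3 := t s1 s2.
Definition chord_b : Ahat 3 := t s2 s3.

Inductive oneFF_relation : set (Ahat 3) :=
| OneFFRelation u x y : fil 1 u -> oneFF_relation (u * (x * y - y * x)).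

Lemma oneFF_relation_fil : oneFF_relation `<=` fil 1.
Proof. by move=> _ [u x y fu]; apply: filMr. Qed.

Definition A1FF := cquot (Relators oneFF_relation_fil).
HB.instance Definition _ := CFAlg.on A1FF.
HB.instance Definition _ := EqQuotient.on A1FF.

(* Main.v *)
(* Modulo 1FF every element u of positive degree satisfies u[x,y] = 0, while
   a + b + c is central.  So k := [a,b] = [b,c] = [c,a] is killed on the left by
   elements of positive degree and on the right by a + b + c, and the elements
   k f(a,b), for commutative power series f, form a right module on which c acts
   as -(a+b).  The right-hand side of the hexagon expands to
     e^b e^c + k (lambda(a,b) e^b e^c + lambda(c,b) e^c + lambda(c,a)),
   and e^(b+c) - e^b e^c = k T with abc T = a e^c + b + c e^(-a).  After
   multiplication by e^a the hexagon becomes k times the equation for lambda, and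
   k f(a,b) = 0 forces f = 0, as one sees in a ring of upper triangular 2x2
   matrices of power series. *)

From HB Require Import structures.
Require Import Defs.
From mathcomp Require Import all_boot all_order all_algebra.
From mathcomp Require Import boolp classical_sets.
From mathcomp Require Import ring.

Set Implicit Arguments.
Unset Strict Implicit.
Unset Printing Implicit Defensive.

Import GRing.Theory.

Local Open Scope ring_scope.
Local Open Scope quotient_scope.

(** * Convergent series, exponentials and inverses in a complete filtered algebra *)

Section Series.
Variable A : cfAlgType.
Implicit Types (x y : A) (u v : nat -> A).

Lemma eq_fil x y : (forall n, fil n (x - y)) -> x = y.
Proof. by move=> h; apply/eqP; rewrite -subr_eq0; apply/eqP/fil_separated. Qed.

Lemma filZ d (k : rat) x : fil d x -> fil d (k *: x).
Proof. by move=> fx; rewrite -mulr_algl; apply: filMl. Qed.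

Lemma filX x k : fil 1 x -> fil k (x ^+ k).
Proof.
move=> fx; elim: k => [|k IHk]; first exact: filT.
by rewrite exprS -add1n; apply: filM.
Qed.

Lemma series_sum_fil d u : (forall k, fil k (u k)) ->
  (forall k, fil d (u k)) -> fil d (series_sum u).
Proof.
move=> uk ud; rewrite -(subrK (\sum_(k < d) u k) (series_sum u)).
by apply: filD; [apply: series_sumP | apply: fil_sum].
Qed.

Lemma series_sumD u v : (forall k, fil k (u k)) -> (forall k, fil k (v k)) ->
  series_sum (fun k => u k + v k) = series_sum u + series_sum v.
Proof.
move=> uk vk; apply: series_sum_unique => n.
by rewrite big_split opprD addrACA; apply: filD; apply: series_sumP.
Qed.

Lemma series_sumZ (c : rat) u : (forall k, fil k (u k)) ->
  series_sum (fun k => c *: u k) = c *: series_sum u.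
Proof.
move=> uk; apply: series_sum_unique => n.
by rewrite -scaler_sumr -scalerBr; apply: filZ; apply: series_sumP.
Qed.

Lemma series_sum_shift u : (forall k, fil k (u k)) ->
  (forall k, fil k (u k.+1)) ->
  series_sum u = u 0%N + series_sum (fun k => u k.+1).
Proof.
move=> uk usk; apply: eq_fil => n; have [->|n_gt0] := posnP n; first exact: filT.
rewrite -(subrK (\sum_(k < n.+1) u k) (series_sum u)) -addrA; apply: filD.
  by apply: (@fil_le _ n n.+1) => //; apply: series_sumP.
rewrite big_ord_recl opprD addrACA subrr add0r -opprB; apply: filN.
exact: (@series_sumP _ (fun k => u k.+1)).
Qed.

(** Cauchy product. The first [n] diagonals regroup as [u i] times the first [n - i] terms of [v];
    the error left in that factor lies in [fil (n - i)], and [u i] supplies the missing [i]. *)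
Lemma series_sumM u v : (forall k, fil k (u k)) -> (forall k, fil k (v k)) ->
  series_sum (fun d => \sum_(i < d.+1) u i * v (d - i)%N)
  = series_sum u * series_sum v.
Proof.
move=> uk vk; apply: series_sum_unique => n.
have -> : \sum_(d < n) \sum_(i < d.+1) u i * v (d - i)%N
    = \sum_(i < n) u i * \sum_(j < n - i) v j.
  elim: n => [|n IHn]; first by rewrite !big_ord0.
  rewrite big_ord_recr IHn [RHS]big_ord_recr /= subSnn big_ord1.
  rewrite [X in _ + X]big_ord_recr /= subnn addrA -big_split /=.
  congr (_ + _); apply: eq_bigr => i _.
  by rewrite -mulrDr subSn ?big_ord_recr //= ltnW.
rewrite -[series_sum u](subrK (\sum_(i < n) u i)) mulrDl -addrA.
apply: filD; first by apply: filMr; apply: series_sumP.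
rewrite mulr_suml -sumrB; apply: fil_sum => i _.
rewrite -mulrBr -[n in fil n _](subnKC (ltnW (ltn_ord i))).
by apply: filM => //; apply: series_sumP.
Qed.

Lemma exp_term_fil x k : fil 1 x -> fil k ((k`!%:R)^-1 *: x ^+ k : A).
Proof. by move=> fx; apply: filZ; apply: filX. Qed.

Lemma expD x y : fil 1 x -> fil 1 y -> GRing.comm x y ->
  exp (x + y) = exp x * exp y.
Proof.
move=> fx fy cxy; rewrite /exp -series_sumM; first last.
- by move=> k; apply: exp_term_fil.
- by move=> k; apply: exp_term_fil.
congr series_sum; apply: funext => d.
(* The binomial formula indexes by the exponent of [y], the Cauchy product by that of [x], so the
   sum is reversed. *)
rewrite exprDn_comm // scaler_sumr; rewrite (reindex_inj rev_ord_inj) /=.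
apply: eq_bigr => i _; have le_id : (i <= d)%N by rewrite -ltnS.
rewrite subSS subKn // -scalerAl -scalerAr scalerA -scaler_nat scalerA.
congr (_ *: _); rewrite bin_sub //.
have fact0 m : (m`!%:R : rat) != 0 by rewrite Num.Theory.pnatr_eq0 -lt0n fact_gt0.
rewrite -[X in X%:R^-1 * _](bin_fact le_id) !natrM.
have b0 : ('C(d, i)%:R : rat) != 0 by rewrite Num.Theory.pnatr_eq0 -lt0n bin_gt0.
by field; rewrite b0 !fact0.
Qed.

Lemma exp0 : exp (0 : A) = 1.
Proof.
rewrite /exp; apply: series_sum_unique => -[|n]; first exact: filT.
rewrite big_ord_recl big1 => [|i _]; last by rewrite expr0n scaler0.
by rewrite invr1 scale1r addr0 subrr; apply: fil0.
Qed.

(* (exp x - 1) / x *)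
Definition expq x := series_sum (fun k => (k.+1`!%:R)^-1 *: x ^+ k).

Lemma exp_expq x : fil 1 x -> exp x = 1 + x * expq x.
Proof.
move=> fx; apply: series_sum_unique => -[|n]; first exact: filT.
rewrite big_ord_recl invr1 scale1r opprD addrACA subrr add0r.
under eq_bigr do rewrite exprS scalerAr.
rewrite -mulr_sumr -mulrBr; apply: (@filM _ 1 n) => //.
apply: (@series_sumP _ (fun k => (k.+1`!%:R)^-1 *: x ^+ k)) => k.
by apply: filZ; apply: filX.
Qed.

Lemma exp_sub1_fil x : fil 1 x -> fil 1 (exp x - 1).
Proof. by move=> fx; rewrite exp_expq // addrC addKr; apply: filMr. Qed.

(* The divided difference of [expq] at [x] and [y]. *)
Definition expq_dd x y :=
  series_sum (fun k => (k.+2`!%:R)^-1 *: \sum_(i < k.+1) x ^+ (k - i) * y ^+ i).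

Lemma expq_ddP x y : fil 1 x -> fil 1 y -> GRing.comm x y ->
  expq x - expq y = (x - y) * expq_dd x y.
Proof.
move=> fx fy cxy; rewrite /expq -scaleN1r -series_sumZ; last first.
  by move=> k; apply: filZ; apply: filX.
rewrite -series_sumD; first last.
- by move=> k; do 2!apply: filZ; apply: filX.
- by move=> k; apply: filZ; apply: filX.
apply: series_sum_unique => -[|n]; first exact: filT.
(* The constant terms cancel. The [n] remaining terms each carry a factor [x - y], whose degree
   makes up for the index shift. *)
rewrite big_ord_recl /= !expr0 scaleN1r subrr add0r.
rewrite (eq_bigr (fun k : 'I_n => (x - y) *
   ((k.+2`!%:R)^-1 *: \sum_(i < k.+1) x ^+ (k - i) * y ^+ i))); last first.
  by move=> i _; rewrite scaleN1r -scalerBr subrXX_comm // scalerAr.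
rewrite -mulr_sumr -mulrBr; apply: (@filM _ 1 n); first exact: filB.
apply: (@series_sumP _ (fun k => (k.+2`!%:R)^-1 *:
  \sum_(i < k.+1) x ^+ (k - i) * y ^+ i)) => k.
apply: filZ; apply: fil_sum => i _.
have {1}-> : k = (k - i + i)%N by rewrite subnK // -ltnS.
by apply: filM; apply: filX.
Qed.

(** Geometric series in [1 - x]. Both [s = 1 + y * s] and [s = 1 + s * y] are proved, since the
    algebra is noncommutative and the inverse must be two-sided. *)
Lemma unit_fil x : fil 1 (x - 1) -> x \is a GRing.unit.
Proof.
move=> fx; pose y := 1 - x.
have fy : fil 1 y by rewrite /y -opprB; apply: filN.
pose s := series_sum (fun k => y ^+ k).
have sE : s = 1 + y * s.
  apply: series_sum_unique => -[|n]; first exact: filT.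
  rewrite big_ord_recl expr0 opprD addrACA subrr add0r.
  under eq_bigr do rewrite exprS.
  rewrite -mulr_sumr -mulrBr; apply: (@filM _ 1 n) => //.
  by apply: (@series_sumP _ (fun k => y ^+ k)) => k; apply: filX.
have sE' : s = 1 + s * y.
  apply: series_sum_unique => -[|n]; first exact: filT.
  rewrite big_ord_recl expr0 opprD addrACA subrr add0r.
  under eq_bigr do rewrite exprSr.
  rewrite -mulr_suml -mulrBl; apply: (@fil_le _ _ (n + 1)).
    by rewrite addn1.
  apply: (@filM _ n 1) => //.
  by apply: (@series_sumP _ (fun k => y ^+ k)) => k; apply: filX.
have xE : x = 1 - y by rewrite /y opprB addrC subrK.
apply/unitrP; exists s; split.
  by rewrite xE mulrBr mulr1 {1}sE' addrK.
by rewrite xE mulrBl mul1r {1}sE addrK.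
Qed.

(** * Evaluation of commutative power series at two elements *)

Section Eval2.
Variables x y : A.
Hypotheses (fx : fil 1 x) (fy : fil 1 y).
Implicit Types f g : pseries2.

Lemma eval2_term_fil f d :
  fil d (\sum_(i < d.+1) f i (d - i)%N *: (x ^+ i * y ^+ (d - i)%N)).
Proof.
apply: fil_sum => i _; apply: filZ.
have {1}-> : d = (i + (d - i))%N by rewrite subnKC // -ltnS.
by apply: filM; apply: filX.
Qed.

Lemma eval2D f g : eval2 (f + g) x y = eval2 f x y + eval2 g x y.
Proof.
rewrite /eval2 -series_sumD; [|exact: eval2_term_fil|exact: eval2_term_fil].
congr series_sum; apply: funext => d; rewrite -big_split /=.
by apply: eq_bigr => i _; rewrite -scalerDl.
Qed.

Lemma eval2Z (k : rat) f : eval2 (k *: f) x y = k *: eval2 f x y.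
Proof.
rewrite /eval2 -series_sumZ; last exact: eval2_term_fil.
congr series_sum; apply: funext => d; rewrite scaler_sumr.
by apply: eq_bigr => i _; rewrite scalerA.
Qed.

Lemma eval2B f g : eval2 (f - g) x y = eval2 f x y - eval2 g x y.
Proof. by rewrite eval2D -scaleN1r eval2Z scaleN1r. Qed.

Lemma eval2_fil d f : fil d f -> fil d (eval2 f x y).
Proof.
move=> ff; apply: series_sum_fil => [k|k]; first exact: eval2_term_fil.
have [le_dk|lt_kd] := leqP d k; 
  first by apply: fil_le le_dk _; apply: eval2_term_fil.
apply: fil_sum => i _; rewrite ff ?scale0r; first exact: fil0.
by rewrite subnKC // -ltnS.
Qed.

Lemma eval2_1 : eval2 1 x y = 1.
Proof.
apply: series_sum_unique => -[|n]; first exact: filT.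
rewrite big_ord_recl big_ord1 scale1r mulr1 big1 ?addr0 ?subrr => [|i _].
  exact: fil0.
apply: big1 => j _; case: j => -[|j] hj /=; rewrite scale0r //.
Qed.

End Eval2.

Lemma eval2C (f : pseries2) x y : fil 1 x -> fil 1 y -> GRing.comm x y ->
  (forall i j, f i j = f j i) -> eval2 f x y = eval2 f y x.
Proof.
move=> fx fy cxy fs; congr series_sum; apply: funext => d.
rewrite (reindex_inj rev_ord_inj) /=; apply: eq_bigr => i _.
rewrite subSS subKn; last by rewrite -ltnS.
by rewrite fs; congr (_ *: _); apply: commrX; apply/commr_sym/commrX.
Qed.

End Series.

(** * Computing with commuting variables behind a left factor *)

(* [eval2] is not multiplicative when [x] and [y] do not commute; this is the
   multiplicativity that survives after a left factor [u] behind which they do. *)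
Definition acts_as (A : cfAlgType) (u x y z : A) (g : pseries2) :=
  forall f, u * eval2 f x y * z = u * eval2 (f * g) x y.

Section ActsAs.
Variables (A : cfAlgType) (u x y : A).
Hypotheses (fx : fil 1 x) (fy : fil 1 y).
Implicit Types (z w : A) (f g h : pseries2).
Local Notation "z ~ g" := (acts_as u x y z g) (at level 70).

Lemma acts_asE z g : z ~ g -> u * z = u * eval2 g x y.
Proof. by move/(_ 1); rewrite eval2_1 // mulr1 mul1r. Qed.

Lemma acts_as1 : 1 ~ 1.
Proof. by move=> f; rewrite !mulr1. Qed.

Lemma acts_asD z w g h : z ~ g -> w ~ h -> z + w ~ g + h.
Proof. by move=> zg wh f; rewrite mulrDr zg wh -mulrDr -eval2D // -mulrDr. Qed.

Lemma acts_asZ (k : rat) z g : z ~ g -> k *: z ~ k *: g.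
Proof. by move=> zg f; rewrite -scalerAr zg scalerAr -eval2Z // scalerAr. Qed.

Lemma acts_asN z g : z ~ g -> - z ~ - g.
Proof. by move=> zg; rewrite -!scaleN1r; apply: acts_asZ. Qed.

Lemma acts_asB z w g h : z ~ g -> w ~ h -> z - w ~ g - h.
Proof. by move=> zg wh; apply: acts_asD => //; apply: acts_asN. Qed.

(** This is why [acts_as] quantifies over [f]: [z] turns [f] into [f * g], and [w] is then applied
    to the series [f * g]. *)
Lemma acts_asM z w g h : z ~ g -> w ~ h -> z * w ~ g * h.
Proof. by move=> zg wh f; rewrite mulrA zg wh mulrA. Qed.

Lemma acts_asX z g n : z ~ g -> z ^+ n ~ g ^+ n.
Proof.
move=> zg; elim: n => [|n IHn]; first exact: acts_as1.
by rewrite !exprS; apply: acts_asM.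
Qed.

Lemma acts_as_sum n (v : nat -> A) (w : nat -> pseries2) :
  (forall k, (k < n)%N -> v k ~ w k) -> \sum_(k < n) v k ~ \sum_(k < n) w k.
Proof.
elim: n => [|n IHn] vw.
  by rewrite !big_ord0; have := acts_asZ 0 acts_as1; rewrite !scale0r.
rewrite !big_ord_recr; apply: acts_asD; last exact: vw.
by apply: IHn => k lt_kn; apply: vw; apply: ltnW.
Qed.

(** Finite sums pass by linearity. Both tails after [n] terms lie in [fil n], and separatedness
    concludes. *)
Lemma acts_as_series (v : nat -> A) (w : nat -> pseries2) :
  (forall k, fil k (v k)) -> (forall k, fil k (w k)) ->
  (forall k, v k ~ w k) -> series_sum v ~ series_sum w.
Proof.
move=> fv fw vw f; apply: eq_fil => n.
have vwn := @acts_as_sum n v w (fun k _ => vw k).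
rewrite -(subrK (u * eval2 f x y * \sum_(k < n) v k) (_ * series_sum v)).
rewrite -addrA; apply: filD.
  by rewrite -mulrBr; apply: filMl; apply: series_sumP.
rewrite vwn -mulrBr -eval2B // -mulrBr -opprB mulrN; apply: filMl.
apply: eval2_fil => //; apply: filN; apply: filMl; exact: series_sumP.
Qed.

Lemma acts_as_exp z g : fil 1 z -> fil 1 g -> z ~ g -> exp z ~ exp g.
Proof.
move=> fz fg zg; apply: acts_as_series => k; try exact: exp_term_fil.
by apply: acts_asZ; apply: acts_asX.
Qed.

Lemma acts_as_expq z g : fil 1 z -> fil 1 g -> z ~ g -> expq z ~ expq g.
Proof.
move=> fz fg zg; apply: acts_as_series => k; try by apply: filZ; apply: filX.
by apply: acts_asZ; apply: acts_asX.
Qed.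

Lemma acts_as_eval2 f z w g h : fil 1 z -> fil 1 g -> fil 1 w -> fil 1 h ->
  z ~ g -> w ~ h -> eval2 f z w ~ eval2 f g h.
Proof.
move=> fz fg fw fh zg wh; apply: acts_as_series => d; try exact: eval2_term_fil.
apply: (@acts_as_sum _ (fun i => f i (d - i)%N *: (z ^+ i * w ^+ (d - i)%N))
  (fun i => f i (d - i)%N *: (g ^+ i * h ^+ (d - i)%N))) => i _.
by apply: acts_asZ; apply: acts_asM; apply: acts_asX.
Qed.

Hypothesis u_comm : forall w, u * w * x * y = u * w * y * x.

Let comm_pow i j : u * (x ^+ i * y ^+ j) * x = u * (x ^+ i.+1 * y ^+ j).
Proof.
elim: j => [|j IHj]; first by rewrite !mulr1 exprSr mulrA.
rewrite exprSr 2!mulrA -(mulrA u) -u_comm IHj -!mulrA.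
by rewrite -exprSr mulrA.
Qed.

Lemma mulr_varA0 f j : (f * varA) 0%N j = 0.
Proof.
rewrite [LHS]pseries2_mulE big_ord1 big1 // => q _ /=.
by rewrite mulr0.
Qed.

Lemma mulr_varAS f i j : (f * varA) i.+1 j = f i j.
Proof.
rewrite [LHS]pseries2_mulE big_ord_recr /= subnn.
rewrite [X in _ + X]big1 => [|q _]; last by rewrite mulr0.
rewrite addr0 big_ord_recr /= subSnn big1 => [|p _]; last first.
  rewrite big1 // => q _; rewrite subSn; last exact: ltnW.
  by rewrite eqSS -[_ == 0%N]negbK -lt0n subn_gt0 ltn_ord mulr0.
rewrite add0r big_ord_recr /= subnn mulr1 big1 ?add0r // => q _.
by rewrite -[_ == 0%N]negbK -lt0n subn_gt0 ltn_ord mulr0.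
Qed.

Lemma mulr_varB0 f i : (f * varB) i 0%N = 0.
Proof.
rewrite [LHS]pseries2_mulE big1 // => p _; rewrite big_ord1 /=.
by case: ifP => _ /=; rewrite mulr0.
Qed.

Lemma mulr_varBS f i j : (f * varB) i j.+1 = f i j.
Proof.
rewrite [LHS]pseries2_mulE big_ord_recr /= subnn /= big1 => [|p _]; last first.
  rewrite big1 // => q _.
  by rewrite -[_ == 0%N]negbK -lt0n subn_gt0 ltn_ord mulr0.
rewrite add0r 2!big_ord_recr /= subSnn subnn mulr1 mulr0 addr0.
rewrite big1 ?add0r // => q _.
by rewrite subSn 1?ltnW // eqSS -[_ == 0%N]negbK -lt0n subn_gt0 ltn_ord mulr0.
Qed.

Let term f d := \sum_(i < d.+1) f i (d - i)%N *: (x ^+ i * y ^+ (d - i)%N).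

(** A degree-by-degree criterion: right multiplication by [z] sends the part of degree [d] of [f] to
    the part of degree [d.+1] of [f * g], whose part of degree 0 vanishes. *)
Let acts_as_var z g : fil 1 z -> (forall f, term (f * g) 0%N = 0) ->
  (forall f d, u * term f d * z = u * term (f * g) d.+1) -> z ~ g.
Proof.
move=> fz t0 tS f; rewrite [eval2 (f * g) x y]series_sum_shift; first last.
- by move=> d; apply: (@fil_le _ _ d.+1) => //; apply: eval2_term_fil.
- by move=> d; apply: eval2_term_fil.
rewrite [X in _ * (X + _)]t0 add0r.
apply: eq_fil => n.
rewrite -(subrK (u * (\sum_(d < n) term f d) * z) (_ * z)) -addrA; apply: filD.
  rewrite -mulrBl -mulrBr; apply: filMr; apply: filMl.
  by apply: series_sumP => d; apply: eval2_term_fil.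
rewrite mulr_sumr mulr_suml; under eq_bigr do rewrite tS.
rewrite -mulr_sumr -mulrBr.
apply: filMl; rewrite -opprB; apply: filN.
apply: (@series_sumP _ (fun d => term (f * g) d.+1)) => d.
by apply: (@fil_le _ _ d.+1) => //; apply: eval2_term_fil.
Qed.

(** In [eval2] the powers of [y] stand on the right, so [x] must pass them to join its own powers;
    [comm_pow] does this behind [u]. *)
Lemma acts_as_varA : x ~ varA.
Proof.
apply: acts_as_var => // [f|f d].
  by rewrite /term big_ord1 mulr_varA0 scale0r.
rewrite /term [in RHS]big_ord_recl mulr_varA0 scale0r add0r !mulr_sumr mulr_suml.
apply: eq_bigr => i _; rewrite /= /bump leq0n add1n subSS mulr_varAS.
by rewrite -!scalerAr -scalerAl comm_pow.
Qed.

Lemma acts_as_varB : y ~ varB.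
Proof.
apply: acts_as_var => // [f|f d].
  by rewrite /term big_ord1 mulr_varB0 scale0r.
rewrite /term [in RHS]big_ord_recr /= subnn mulr_varB0 scale0r addr0.
rewrite !mulr_sumr mulr_suml; apply: eq_bigr => i _.
rewrite subSn; last by rewrite -ltnS.
by rewrite mulr_varBS -!scalerAr -scalerAl exprSr !mulrA.
Qed.

End ActsAs.

(** * Power series in two variables and the quotient [bch_quot] *)

Lemma varA_fil : fil 1 varA.
Proof. by move=> [|i] [|j]. Qed.

Lemma varB_fil : fil 1 varB.
Proof. by move=> [|i] [|j]. Qed.

Lemma varB_neq0 : varB != 0.
Proof. by apply/eqP => /(congr1 (fun f : pseries2 => f 0%N 1%N)). Qed.

Lemma pseries2_monomialE (k l i j : nat) :
  (varA ^+ k * varB ^+ l) i j = ((i == k) && (j == l))%:R.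
Proof.
elim: l j => [|l IHl] [|j]; last by rewrite exprSr mulrA mulr_varBS IHl eqSS.
- rewrite mulr1 eqxx andbT; elim: k i => [|k IHk] [|i] //=.
    by rewrite exprSr mulr_varA0.
  by rewrite exprSr mulr_varAS IHk eqSS.
- rewrite mulr1 andbF; elim: k i => [|k IHk] [|i] //=.
    by rewrite exprSr mulr_varA0.
  by rewrite exprSr mulr_varAS IHk.
by rewrite exprSr mulrA mulr_varB0 andbF.
Qed.

(** Used from right to left with [acts_as_eval2]: it shows that [eval2 f x y] acts as [f] itself. *)
Lemma eval2_var (f : pseries2) : eval2 f varA varB = f.
Proof.
apply: series_sum_unique => n i j lt_n.
rewrite [LHS](_ : _ = f i j - (\sum_(d < n) \sum_(p < d.+1)
  f p (d - p)%N *: (varA ^+ p * varB ^+ (d - p)) : pseries2) i j) //.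
(* The coefficient at [(i, j)] comes only from degree [d = i + j] and, within it, from [p = i]. *)
rewrite !pseries_sumE (bigD1 (Ordinal lt_n)) //=.
have lt_i : (i < (i + j).+1)%N by rewrite ltnS leq_addr.
rewrite !pseries_sumE (bigD1 (Ordinal lt_i)) //= pseries2_monomialE addKn.
rewrite !eqxx mulr1.
rewrite big1 => [|p]; last first.
  rewrite -val_eqE /= => ne_p; rewrite pseries2_monomialE eq_sym.
  by rewrite (negbTE ne_p) mulr0.
rewrite big1 => [|d]; first by rewrite !addr0 subrr.
rewrite -val_eqE /= => ne_d; rewrite !pseries_sumE big1 // => p _.
rewrite /= pseries2_monomialE; case: eqP => [ip|]; last by rewrite mulr0.
case: eqP => [jp|]; last by rewrite mulr0.
case/eqP: ne_d; rewrite ip jp subnKC // -ltnS; exact: ltn_ord.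
Qed.

(* With [b = varA] and [c = varB], [exp (b + c) - exp b * exp c] is
   [[b, c] * bch_quot] in [A1FF]. *)
Definition bch_quot : pseries2 :=
  expq_dd (varA + varB) varA - expq varA * expq varB.

Lemma varAB_fil : fil 1 (varA + varB).
Proof. by apply: filD; [exact: varA_fil | exact: varB_fil]. Qed.

(** The divided difference at [varA + varB] and [varA] has denominator [varB], and [exp varB] is
    [1 + varB * expq varB]. *)
Lemma bch_quot_varB :
  expq (varA + varB) - expq varA * exp varB = varB * bch_quot.
Proof.
have fA := varA_fil; have fB := varB_fil; have fAB := varAB_fil.
rewrite /bch_quot mulrBr (mulrCA varB) exp_expq //.
have := expq_ddP fAB fA (mulrC _ _); rewrite (addrC varA) addrK addrC => <-.
set x := expq _; set y := expq varA; set z := expq _; ring.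
Qed.

(** After multiplication by [varB], which can be cancelled, this follows from [bch_quot_varB] and
    from [exp] turning the sum into a product. *)
Lemma bch_quot_varA : expq (varA + varB) - expq varB = - (varA * bch_quot).
Proof.
have fA := varA_fil; have fB := varB_fil; have fAB := varAB_fil.
apply: (mulfI varB_neq0).
rewrite mulrN mulrCA -bch_quot_varB.
have eAB := expD fA fB (mulrC _ _).
rewrite !exp_expq // in eAB *.
move: (expq (varA + varB)) (expq varA) (expq varB) eAB => x y z eAB.
have -> : varB * (x - z)
    = (1 + (varA + varB) * x) - 1 - varA * x - varB * z by ring.
by rewrite eAB; ring.
Qed.

(** * Commutators, and the hexagon in an algebra where positive degree kills them *)

Section Lie.
Variable A : cfAlgType.
Implicit Types x y z : A.

Lemma fil_lie x y : fil 1 x -> fil 1 (lie x y).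
Proof. by move=> fx; apply: filB; [apply: filMr|apply: filMl]. Qed.

Lemma lieC x y : lie x y = - lie y x.
Proof. by rewrite /lie opprB. Qed.

Lemma lieDr x y z : lie x (y + z) = lie x y + lie x z.
Proof. by rewrite /lie mulrDr mulrDl opprD addrACA. Qed.

Lemma liexx x : lie x x = 0.
Proof. exact: subrr. Qed.

Lemma lie_eq0 x y : lie x y = 0 -> x * y = y * x.
Proof. by move/eqP; rewrite subr_eq0 => /eqP. Qed.

(** Turns a 4T relation into an equality between two commutators of chords. *)
Lemma lie0_opp x y z : lie (x + y) z = 0 -> lie z y = lie x z.
Proof.
by rewrite lieC lieDr => /eqP; rewrite oppr_eq0 addrC addr_eq0 -lieC => /eqP.
Qed.

End Lie.

Section OneFF.
Variable A : cfAlgType.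
Hypothesis mulr_lie : forall u x y : A, fil 1 u -> u * lie x y = 0.

Lemma oneFF_comm (u w x y : A) : fil 1 u -> u * w * x * y = u * w * y * x.
Proof.
move=> fu; apply/eqP; rewrite -subr_eq0 -(mulr_lie x y (filMr w fu)).
by rewrite /lie mulrBr !mulrA.
Qed.

(** The left side is [b * (expq (b + c) - expq b * exp c) + c * (expq (b + c) - expq c)]. Behind [b]
    or [c] the parentheses can be computed in commuting variables, where [bch_quot_varB] and
    [bch_quot_varA] give [c * W] and [- (b * W)]; the sum is [lie b c * W]. *)
Lemma oneFF_exp (b c : A) : fil 1 b -> fil 1 c ->
  exp (b + c) - exp b * exp c = lie b c * eval2 bch_quot b c.
Proof.
move=> fb fc; have fbc : fil 1 (b + c) by apply: filD.
have fA := varA_fil; have fB := varB_fil; have fAB := varAB_fil.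
have actA u : fil 1 u -> acts_as u b c b varA.
  by move=> fu; apply: acts_as_varA => // w; apply: oneFF_comm.
have actB u : acts_as u b c c varB by apply: acts_as_varB.
have actAB u : fil 1 u -> acts_as u b c (b + c) (varA + varB).
  by move=> fu; apply: acts_asD => //; apply: actA.
have actW u : fil 1 u -> acts_as u b c (eval2 bch_quot b c) bch_quot.
  move=> fu; rewrite -[X in acts_as _ _ _ _ X]eval2_var.
  by apply: acts_as_eval2 => //; apply: actA.
set W := eval2 bch_quot b c in actW *.
have Eb : b * (expq (b + c) - expq b * exp c) = b * (c * W).
  have act1 : acts_as b b c (expq (b + c) - expq b * exp c)
      (expq (varA + varB) - expq varA * exp varB).
    apply: acts_asB => //; first by apply: acts_as_expq => //; apply: actAB.
    apply: acts_asM; first by apply: acts_as_expq => //; apply: actA.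
    exact: acts_as_exp.
  rewrite (acts_asE act1) bch_quot_varB.
  by rewrite (acts_asE (acts_asM (actB b) (actW _ fb))).
have Ec : c * (expq (b + c) - expq c) = - (c * (b * W)).
  have act1 : acts_as c b c (expq (b + c) - expq c)
      (expq (varA + varB) - expq varB).
    apply: acts_asB => //; apply: acts_as_expq => //; exact: actAB.
  rewrite -mulrN (acts_asE act1) bch_quot_varA.
  have act2 := acts_asN fb fc (acts_asM (actA _ fc) (actW _ fc)).
  by rewrite (acts_asE act2).
rewrite [RHS]mulrBl -2!mulrA -Eb -Ec.
have ecE : c * expq c = exp c - 1 by rewrite exp_expq // addrC addKr.
rewrite !mulrBr ecE (exp_expq fbc) (exp_expq fb) !mulrDl mul1r !mulrA.
rewrite opprB [RHS]addrACA opprD -[LHS]addrA addrCA; congr (_ + _).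
by rewrite addrA addrC.
Qed.

Variables a b c : A.
Hypotheses (fa : fil 1 a) (fb : fil 1 b) (fc : fil 1 c).
Hypotheses (lie_bc : lie b c = lie a b) (lie_ca : lie c a = lie a b).
Local Notation k := (lie a b).

(** The sum [z] commutes with [a] and [b], hence with [k]. Behind [k] it moves left past [w], then
    past [k], and [z * k = 0] because [z] has positive degree. *)
Lemma lie_central w : k * w * (a + b + c) = 0.
Proof.
set z := a + b + c; have fk : fil 1 k := fil_lie b fa.
have za : a * z = z * a.
  by apply: lie_eq0; rewrite !lieDr liexx add0r (lieC a c) lie_ca subrr.
have zb : b * z = z * b.
  by apply: lie_eq0; rewrite !lieDr liexx addr0 lie_bc lieC addNr.
have fz : fil 1 z by do 2?apply: filD.
have zk : k * z = z * k.
  by rewrite /lie mulrBl mulrBr -!mulrA za zb !mulrA za zb.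
have := oneFF_comm 1 w z fk; rewrite mulr1 => ->.
by rewrite zk mulr_lie // mul0r.
Qed.

Lemma acts_as_a : acts_as k a b a varA.
Proof. by apply: acts_as_varA => // w; apply/oneFF_comm/fil_lie. Qed.

Lemma acts_as_b : acts_as k a b b varB.
Proof. exact: acts_as_varB. Qed.

(** Write [c] as [(a + b + c) - (a + b)]; the first term acts as 0 by [lie_central]. *)
Lemma acts_as_c : acts_as k a b c (- (varA + varB)).
Proof.
have -> : c = (a + b + c) - (a + b) by rewrite addrC addKr.
rewrite -[- (varA + varB)]add0r; apply: acts_asB => //; last first.
  by apply: acts_asD => //; [exact: acts_as_a | exact: acts_as_b].
move=> f; rewrite lie_central mulr0.
by have := eval2Z fa fb 0 0; rewrite !scale0r => ->; rewrite mulr0.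
Qed.

Let vC : pseries2 := - (varA + varB).

(* [lie a b] times this is the difference of the two sides of the hexagon. *)
Definition hexagon_defect (lam : pseries2) : pseries2 :=
  eval2 bch_quot varB vC
  - (lam * exp varB * exp vC + eval2 lam vC varB * exp vC + eval2 lam vC varA).

Lemma hexagon_defectE (lam : pseries2) :
  exp (b + c) - (1 + k * eval2 lam a b) * exp b * (1 + k * eval2 lam c b)
    * exp c * (1 + k * eval2 lam c a)
  = k * eval2 (hexagon_defect lam) a b.
Proof.
have fk : fil 1 k := fil_lie b fa.
have fA := varA_fil; have fB := varB_fil; have fAB := varAB_fil.
have fC : fil 1 vC by apply: filN.
have unipM x y : fil 1 (x - 1) -> fil 1 (y - 1) -> fil 1 (x * y - 1 : A).
  move=> fx fy; rewrite -(subrK x (x * y)) -addrA.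
  by apply: filD => //; rewrite -{2}[x]mulr1 -mulrBr; apply: filMl.
(* Since [x - 1] kills [k] from the left, [x * k = k]. Each factor [1 + k * L] of the hexagon thus
   only adds [k * L] to the product before it. *)
have mulk x L : fil 1 (x - 1) -> x * (1 + k * L) = x + k * L.
  move=> fx; rewrite mulrDr mulr1 mulrA -[X in X * k](subrK 1).
  by rewrite (mulrDl (x - 1)) mulr_lie // add0r mul1r.
have unipk L : fil 1 (1 + k * L - 1) by rewrite addrC addKr; apply: filMr.
have unipe x : fil 1 x -> fil 1 (exp x - 1) by apply: exp_sub1_fil.
have unip1 : fil 1 ((1 + k * eval2 lam a b) * exp b - 1).
  by apply: unipM; [apply: unipk | apply: unipe].
have unip2 : fil 1 ((1 + k * eval2 lam a b) * exp b * (1 + k * eval2 lam c b)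
    * exp c - 1).
  by apply: (unipM); [apply: (unipM) | apply: unipe].
rewrite (mulk _ _ unip2) (mulk _ _ unip1).
have -> : ((1 + k * eval2 lam a b) * exp b + k * eval2 lam c b) * exp c
    + k * eval2 lam c a = exp b * exp c
    + k * (eval2 lam a b * exp b * exp c + eval2 lam c b * exp c
           + eval2 lam c a).
  by move: (lie a b) => x; rewrite !mulrDl mul1r !mulrDr !mulrA !addrA.
rewrite opprD addrA oneFF_exp // lie_bc -mulrBr /hexagon_defect.
(* The factor behind [k] is translated piece by piece into commuting variables, with [c] read as
   [vC]. *)
have act : acts_as k a b (eval2 bch_quot b c - (eval2 lam a b * exp b * exp c
    + eval2 lam c b * exp c + eval2 lam c a)) (hexagon_defect lam).
  have actA := acts_as_a; have actB := acts_as_b; have actC := acts_as_c.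
  apply: acts_asB => //; first exact: acts_as_eval2.
  apply: acts_asD => //; [apply: acts_asD => //|exact: acts_as_eval2].
    apply: acts_asM; [apply: acts_asM|]; try exact: acts_as_exp.
    by rewrite -[X in acts_as _ _ _ _ X]eval2_var; apply: acts_as_eval2.
  by apply: acts_asM; [apply: acts_as_eval2 | apply: acts_as_exp].
exact: acts_asE act.
Qed.

End OneFF.

(** * Morphisms of filtered algebras *)

Section FilteredMorphisms.
Variables A B : cfAlgType.

Variant filtered_morphism (phi : A -> B) : Prop := FilteredMorphism of
  {morph phi : x y / x + y} & {morph phi : x y / x * y} & phi 1 = 1 &
  (forall k : rat, {morph phi : x / k *: x}) &
  (forall d x, fil d x -> fil d (phi x)).

Variable phi : A -> B.
Hypothesis phi_morph : filtered_morphism phi.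

Let phiD : {morph phi : x y / x + y}. Proof. by case: phi_morph. Qed.
Let phiM : {morph phi : x y / x * y}. Proof. by case: phi_morph. Qed.
Let phi1 : phi 1 = 1. Proof. by case: phi_morph. Qed.
Let phiZ (k : rat) : {morph phi : x / k *: x}. Proof. by case: phi_morph. Qed.
Let phi_fil d x : fil d x -> fil d (phi x).
Proof. by case: phi_morph => _ _ _ _; apply. Qed.

Lemma filtered_morphism0 : phi 0 = 0.
Proof. by have := phiZ 0 0; rewrite !scale0r. Qed.

Lemma filtered_morphismB : {morph phi : x y / x - y}.
Proof. by move=> x y; rewrite phiD -scaleN1r phiZ scaleN1r. Qed.

Lemma filtered_morphism_lie : {morph phi : x y / lie x y}.
Proof. by move=> x y; rewrite /lie filtered_morphismB !phiM. Qed.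

Lemma filtered_morphismX x k : phi (x ^+ k) = phi x ^+ k.
Proof. by elim: k => [//|k IHk]; rewrite !exprS phiM IHk. Qed.

Lemma filtered_morphism_mulVr x :
  x \is a GRing.unit -> phi x^-1 * phi x = 1.
Proof. by move=> ux; rewrite -phiM mulVr. Qed.

Lemma filtered_morphism_sum (I : Type) (r : seq I) (P : pred I) (F : I -> A) :
  phi (\sum_(i <- r | P i) F i) = \sum_(i <- r | P i) phi (F i).
Proof. exact: (big_morph _ phiD filtered_morphism0). Qed.

Lemma filtered_morphism_series (u : nat -> A) : (forall k, fil k (u k)) ->
  phi (series_sum u) = series_sum (fun k => phi (u k)).
Proof.
move=> fu; apply/esym/series_sum_unique => n.
rewrite -filtered_morphism_sum -filtered_morphismB; apply: phi_fil.
exact: series_sumP.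
Qed.

Lemma filtered_morphism_exp x : fil 1 x -> phi (exp x) = exp (phi x).
Proof.
move=> fx; rewrite /exp filtered_morphism_series; last first.
  by move=> k; apply: exp_term_fil.
by congr series_sum; apply: funext => k; rewrite phiZ filtered_morphismX.
Qed.

Lemma filtered_morphism_eval2 f x y : fil 1 x -> fil 1 y ->
  phi (eval2 f x y) = eval2 f (phi x) (phi y).
Proof.
move=> fx fy; rewrite /eval2 filtered_morphism_series; last first.
  exact: eval2_term_fil.
congr series_sum; apply: funext => d; rewrite filtered_morphism_sum.
by apply: eq_bigr => i _; rewrite phiZ phiM !filtered_morphismX.
Qed.

Lemma filtered_morphism_add1_lie f x y : fil 1 x -> fil 1 y ->
  phi (1 + lie x y * eval2 f x y)
  = 1 + lie (phi x) (phi y) * eval2 f (phi x) (phi y).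
Proof.
by move=> fx fy; rewrite phiD phi1 phiM filtered_morphism_lie
  filtered_morphism_eval2.
Qed.

(** The kernel of [phi] is a two-sided ideal. It is closed because [phi] respects the filtrations
    and [B] is separated, so it contains the closed ideal generated by [G]. *)
Lemma filtered_morphism_quot (G : relators A) :
  (forall r, relator G r -> phi r = 0) ->
  forall x y, \pi_(cquot G) x = \pi_(cquot G) y -> phi x = phi y.
Proof.
move=> G0 x y /cquot_eqP xy; apply/eqP; rewrite -subr_eq0 -filtered_morphismB.
apply/eqP; move: {x y} (x - y) xy.
apply: (closed_ideal_sub (J := [set x | phi x = 0])) => //.
  split=> /= [|x y x0 y0|x y y0|x y x0]; first exact: filtered_morphism0.
  - by rewrite filtered_morphismB x0 y0 subrr.
  - by rewrite phiM y0 mulr0.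
  - by rewrite phiM x0 mul0r.
move=> x hx; apply: fil_separated => d; have [y /= y0 fxy] := hx d.
by rewrite -[phi x]subr0 -y0 -filtered_morphismB; apply: phi_fil.
Qed.

End FilteredMorphisms.

Lemma filtered_morphism_comp (A B C : cfAlgType) (psi : B -> C) (phi : A -> B) :
  filtered_morphism psi -> filtered_morphism phi ->
  filtered_morphism (psi \o phi).
Proof.
move=> [pD pM p1 pZ pf] [qD qM q1 qZ qf]; split=> /=.
- by move=> x y /=; rewrite qD pD.
- by move=> x y /=; rewrite qM pM.
- by rewrite q1 p1.
- by move=> k x /=; rewrite qZ pZ.
- by move=> d x fx; apply/pf/qf.
Qed.

Lemma filtered_morphism_pi (A : cfAlgType) (G : relators A) :
  filtered_morphism (fun x => \pi_(cquot G) x).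
Proof.
split; [exact: piD | exact: piM | exact: pi1 | exact: piZ |].
by move=> d x fx; exists x.
Qed.

Lemma filtered_morphism_Ahat n (B : cfAlgType) (g : 'I_n * 'I_n -> B) :
  chord_compatible g -> filtered_morphism (Ahat_map g).
Proof.
move=> g_compat; split.
- exact: Ahat_mapD.
- exact: Ahat_mapM.
- exact: Ahat_map1.
- exact: Ahat_mapZ.
- exact: Ahat_map_fil.
Qed.

(** * The triangular matrix model *)

Definition const_coef (f : pseries2) : rat := f 0%N 0%N.
Arguments const_coef : simpl never.

Lemma const_coefM f g : const_coef (f * g) = const_coef f * const_coef g.
Proof. by rewrite /const_coef [LHS]pseries2_mulE !big_ord1. Qed.

Lemma const_coefD f g : const_coef (f + g) = const_coef f + const_coef g.
Proof. by []. Qed.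

Lemma const_coefZ k f : const_coef (k *: f) = k * const_coef f.
Proof. by []. Qed.

Lemma const_coef1 : const_coef 1 = 1. Proof. by []. Qed.

Lemma const_coef_fil1 f : fil 1 f -> const_coef f = 0.
Proof. by apply. Qed.

(* [MatModel p v] stands for the matrix [[p(0,0), v], [0, p]]: commutators have
   [p = 0], and are therefore annihilated on the left by the elements of [fil 1].
   The corner is shifted by one in the filtration, so that it may be [1] in
   degree one. *)
Record matmodel := MatModel { diag : pseries2; corner : pseries2 }.

HB.instance Definition _ := gen_eqMixin matmodel.
HB.instance Definition _ := gen_choiceMixin matmodel.

Section MatModel.
Implicit Types x y z : matmodel.

Definition matmodel_zero := MatModel 0 0.
Definition matmodel_one := MatModel 1 0.
Definition matmodel_opp x := MatModel (- diag x) (- corner x).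
Definition matmodel_add x y := MatModel (diag x + diag y) (corner x + corner y).
Definition matmodel_mul x y := MatModel (diag x * diag y)
  (const_coef (diag x) *: corner y + corner x * diag y).
Definition matmodel_scale (k : rat) x := MatModel (k *: diag x) (k *: corner x).

Fact matmodel_addA : associative matmodel_add.
Proof. by move=> x y z; rewrite /matmodel_add !addrA. Qed.
Fact matmodel_addC : commutative matmodel_add.
Proof. by move=> x y; congr MatModel; rewrite addrC. Qed.
Fact matmodel_add0 : left_id matmodel_zero matmodel_add.
Proof. by case=> p v; rewrite /matmodel_add !add0r. Qed.
Fact matmodel_addN : left_inverse matmodel_zero matmodel_opp matmodel_add.
Proof. by case=> p v; rewrite /matmodel_add !addNr. Qed.

HB.instance Definition _ := GRing.isZmodule.Build matmodel
  matmodel_addA matmodel_addC matmodel_add0 matmodel_addN.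

Fact matmodel_mulA : associative matmodel_mul.
Proof.
move=> [p v] [q w] [r z]; rewrite /matmodel_mul /=; congr MatModel.
  exact: mulrA.
rewrite const_coefM scalerDr scalerA -addrA mulrDl; congr (_ + (_ + _)).
  exact: scalerAl.
exact: mulrA.
Qed.

Fact matmodel_mul1 : left_id matmodel_one matmodel_mul.
Proof.
case=> p v; rewrite /matmodel_mul /= const_coef1 scale1r mul0r addr0.
by congr MatModel; apply: mul1r.
Qed.

Fact matmodel_mulr1 : right_id matmodel_one matmodel_mul.
Proof. by case=> p v; rewrite /matmodel_mul /= !mulr1 scaler0 add0r. Qed.

Fact matmodel_mulDl : left_distributive matmodel_mul matmodel_add.
Proof.
move=> [p v] [q w] [r z]; congr MatModel; first exact: mulrDl.
by rewrite /= const_coefD scalerDl mulrDl addrACA.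
Qed.

Fact matmodel_mulDr : right_distributive matmodel_mul matmodel_add.
Proof.
move=> [p v] [q w] [r z]; congr MatModel; first exact: mulrDr.
by rewrite /= mulrDr scalerDr addrACA.
Qed.

Fact matmodel_one_neq0 : matmodel_one != 0.
Proof. by apply/eqP => /(congr1 (fun x => const_coef (diag x))). Qed.

HB.instance Definition _ := GRing.Zmodule_isNzRing.Build matmodel
  matmodel_mulA matmodel_mul1 matmodel_mulr1 matmodel_mulDl matmodel_mulDr
  matmodel_one_neq0.

Fact matmodel_scaleA a b x :
  matmodel_scale a (matmodel_scale b x) = matmodel_scale (a * b) x.
Proof. by rewrite /matmodel_scale !scalerA. Qed.
Fact matmodel_scale1 : left_id 1 matmodel_scale.
Proof. by case=> p v; rewrite /matmodel_scale !scale1r. Qed.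
Fact matmodel_scaleDr : right_distributive matmodel_scale +%R.
Proof. by move=> k x y; congr MatModel; apply: scalerDr. Qed.
Fact matmodel_scaleDl x : {morph matmodel_scale^~ x : a b / a + b}.
Proof. by move=> a b; congr MatModel; apply: scalerDl. Qed.

HB.instance Definition _ := GRing.Zmodule_isLmodule.Build rat matmodel
  matmodel_scaleA matmodel_scale1 matmodel_scaleDr matmodel_scaleDl.

Fact matmodel_scaleAl (k : rat) x y : k *: (x * y) = (k *: x) * y.
Proof.
case: x y => [p v] [q w]; congr MatModel; first exact: scalerAl.
by rewrite /= const_coefZ -scalerA -scalerAl -scalerDr.
Qed.
HB.instance Definition _ :=
  GRing.Lmodule_isLalgebra.Build rat matmodel matmodel_scaleAl.

Fact matmodel_scaleAr (k : rat) x y : k *: (x * y) = x * (k *: y).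
Proof.
case: x y => [p v] [q w]; congr MatModel; first exact: scalerAr.
by rewrite /= -scalerAr scalerA (mulrC (const_coef p)) -scalerA -scalerDr.
Qed.
HB.instance Definition _ :=
  GRing.Lalgebra_isAlgebra.Build rat matmodel matmodel_scaleAr.

HB.instance Definition _ := GRing.NzRing_hasMulInverse.Build matmodel
  (@classical_mulVr matmodel) (@classical_mulrV matmodel)
  (@classical_unitP matmodel) (@classical_inv_out matmodel).

Definition matmodel_fil d : set matmodel :=
  [set x : matmodel | fil d (diag x) /\ fil d.-1 (corner x)]%classic.

Fact matmodel_filT x : matmodel_fil 0 x.
Proof. by split; apply: filT. Qed.

Fact matmodel_fil0 d : matmodel_fil d 0.
Proof. by split; apply: fil0. Qed.

Fact matmodel_fil1 : ~ matmodel_fil 1 1.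
Proof. by case=> /= /fil1. Qed.

Fact matmodel_fil_le m n x :
  (m <= n)%N -> matmodel_fil n x -> matmodel_fil m x.
Proof.
by move=> le_mn [f1 f2]; split; [apply: fil_le f1 | apply: fil_le f2];
  rewrite // -!subn1 leq_sub2r.
Qed.

Fact matmodel_filB d x y :
  matmodel_fil d x -> matmodel_fil d y -> matmodel_fil d (x - y).
Proof. by move=> [? ?] [? ?]; split; apply: filB. Qed.

Fact matmodel_filM m n x y :
  matmodel_fil m x -> matmodel_fil n y -> matmodel_fil (m + n)%N (x * y).
Proof.
move=> [fx1 fx2] [fy1 fy2]; split; first exact: filM.
apply: filD; last first.
  apply: fil_le (filM _ _ _ _ fx2 fy1).
  by case: m {fx1 fx2} => //=; rewrite leq_pred.
(* For [m = 0] the corner of [y] is already deep enough; for positive [m] the constant coefficient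
   of [diag x] vanishes. *)
case: m fx1 {fx2} => [|m] fx1; first exact: filZ.
by rewrite const_coef_fil1 ?scale0r; [apply: fil0 | apply: fil_le fx1].
Qed.

Fact matmodel_fil_separated x : (forall d, matmodel_fil d x) -> x = 0.
Proof.
case: x => p v hx; congr MatModel; apply: fil_separated => d.
  by have [] := hx d.
by have [] := hx d.+1.
Qed.

Fact matmodel_fil_complete (u : nat -> matmodel) :
  (forall k, matmodel_fil k (u k)) ->
  exists s, forall n, matmodel_fil n (s - \sum_(k < n) u k).
Proof.
move=> fu; have f1 k : fil k (diag (u k)) by have [] := fu k.
have f2 k : fil k (corner (u k.+1)) by have [] := fu k.+1.
(* Because of the shift, corners of both [u 0] and [u 1] are only known to lie in [fil 0]. The first
   is split off and the rest summed as a series starting at [u 1]. *)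
exists (MatModel (series_sum (fun k => diag (u k)))
  (corner (u 0%N) + series_sum (fun k => corner (u k.+1)))) => n.
have -> : \sum_(k < n) u k =
    MatModel (\sum_(k < n) diag (u k)) (\sum_(k < n) corner (u k)).
  by elim/big_rec3: _ => // i p v x _ ->.
split; first exact: (@series_sumP _ (fun k => diag (u k))).
case: n => [|n]; first exact: filT.
rewrite /= big_ord_recl opprD addrACA subrr add0r.
exact: (@series_sumP _ (fun k => corner (u k.+1))).
Qed.

HB.instance Definition _ := isCompleteFiltered.Build matmodel matmodel_filT
  matmodel_fil0 matmodel_fil1 matmodel_fil_le matmodel_filB matmodel_filM
  matmodel_fil_separated matmodel_fil_complete.

Lemma diag_morphism : filtered_morphism diag.
Proof. by split=> // d x []. Qed.

Lemma matmodel_mulr_lie x y z : fil 1 x -> x * lie y z = 0.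
Proof.
move=> [fx _]; congr MatModel; rewrite /= ?(mulrC (diag z)) ?subrr ?mulr0 //.
by rewrite const_coef_fil1 // scale0r add0r.
Qed.

End MatModel.

(** The chords [a], [b], [c] are given sum 0, so that 4T reduces to an element commuting with its
    opposite. The corner 1 of [a] makes the commutator of [a] and [b] nonzero: its corner is
    [varB]. *)
Definition matmodel_chord (i j : 'I_3) : matmodel :=
  match (val i, val j) with
  | (0, 1) | (1, 0) => MatModel varA 1%R
  | (1, 2) | (2, 1) => MatModel varB 0%R
  | (0, 2) | (2, 0) => MatModel (- (varA + varB))%R (- 1)%R
  | _ => 0%R
  end%N.

Lemma ord3P (i : 'I_3) : [\/ i = s1, i = s2 | i = s3].
Proof.
by case: i => [[|[|[|i]]] hi] //; [apply: Or31|apply: Or32|apply: Or33];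
  apply: val_inj.
Qed.

Lemma matmodel_compat : chord_compatible (fun p => matmodel_chord p.1 p.2).
Proof.
have lieNr (x : matmodel) : lie x (- x) = 0 by rewrite /lie mulrN mulNr subrr.
split=> /= [[i j]|i|i j|i j k hu|i j k l hu].
- by case: (ord3P i) => ->; case: (ord3P j) => ->; split=> //=; try exact: filT;
    try exact: fil0; try (apply: filN; apply: filD);
    first [exact: varA_fil | exact: varB_fil].
- by case: (ord3P i) => ->.
- by case: (ord3P i) => ->; case: (ord3P j) => ->.
- have E : matmodel_chord i j + matmodel_chord j k = - matmodel_chord i k.
    move: hu.
    case: (ord3P i) => ->; case: (ord3P j) => ->; case: (ord3P k) => -> //= _;
    by congr MatModel; rewrite /= ; ring.
  by rewrite E -[X in lie _ X]opprK lieNr.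
- have {}hu : uniq [:: i; j; k; l] := hu.
  (* Locality is vacuous: three strands do not contain four distinct ones. *)
  by have := max_card [in [:: i; j; k; l]]; rewrite (card_uniqP hu) card_ord.
Qed.

(** * The quotient [A1FF] and the faithfulness of its commutator part *)

Lemma pi_A1FF_morphism : filtered_morphism (fun x : Ahat 3 => \pi_A1FF x).
Proof. exact: filtered_morphism_pi. Qed.

Lemma t_fil n (i j : 'I_n) : fil 1 (t i j).
Proof. by have [h _ _ _ _] := t_compat n; apply: (h (i, j)). Qed.

Lemma t_sym n (i j : 'I_n) : t i j = t j i.
Proof. by have [_ _ h _ _] := t_compat n; apply: (h i j). Qed.

Lemma t_4T n (i j k : 'I_n) : uniq [:: i; j; k] ->
  lie (t i j + t j k) (t i k) = 0.
Proof. by have [_ _ _ h _] := t_compat n; apply: (h i j k). Qed.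

Lemma A1FF_mulr_lie (u x y : A1FF) : fil 1 u -> u * lie x y = 0.
Proof.
move=> [v fv <-]; elim/cquotW: x => x; elim/cquotW: y => y.
rewrite /lie -!piM -piB -piM -pi0; apply/cquot_eqP; rewrite subr0.
exact/sub_closed_ideal/OneFFRelation.
Qed.

(** Each 1FF relator goes to a commutator with a left factor of positive degree, which is zero in
    [B]. Applied to [to_matmodel] and to relabelings of strands. *)
Lemma A1FF_factor (B : cfAlgType) (phi : Ahat 3 -> B) :
  filtered_morphism phi -> (forall u x y : B, fil 1 u -> u * lie x y = 0) ->
  forall x y, x = y %[mod A1FF] -> phi x = phi y.
Proof.
move=> phi_morph B_lie; have [_ phiM _ _ phi_fil] := phi_morph.
apply: (@filtered_morphism_quot _ _ _ phi_morph (Relators oneFF_relation_fil)).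
move=> _ [u x y fu]; rewrite phiM (filtered_morphism_lie phi_morph).
exact/B_lie/phi_fil.
Qed.

Definition to_matmodel : Ahat 3 -> matmodel :=
  Ahat_map (fun p => matmodel_chord p.1 p.2).

Lemma to_matmodel_morphism : filtered_morphism to_matmodel.
Proof. exact: filtered_morphism_Ahat matmodel_compat. Qed.

Lemma to_matmodel_lie_eval2 (f : pseries2) :
  to_matmodel (lie chord_a chord_b * eval2 f chord_a chord_b)
  = MatModel 0 (varB * f).
Proof.
have phi_morph := to_matmodel_morphism.
have [_ phiM _ _ _] := phi_morph.
rewrite phiM (filtered_morphism_lie phi_morph).
rewrite (filtered_morphism_eval2 phi_morph _ (t_fil _ _) (t_fil _ _)).
rewrite /to_matmodel.
rewrite !Ahat_map_t; try exact: matmodel_compat.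
set x := eval2 _ _ _.
(* The commutator has zero diagonal, so only the diagonal of the evaluated series enters the
   product, and [diag] is a morphism. *)
have diag_x : diag x = f.
  rewrite /x.
  rewrite (filtered_morphism_eval2 diag_morphism); first exact: eval2_var.
    by have [h _ _ _ _] := matmodel_compat; apply: (h (s1, s2)).
  by have [h _ _ _ _] := matmodel_compat; apply: (h (s2, s3)).
congr MatModel; rewrite /= (mulrC varA) subrr ?mul0r // diag_x.
rewrite (const_coef_fil1 (fil0 1)) (const_coef_fil1 varA_fil).
rewrite (const_coef_fil1 varB_fil) !scale0r.
by rewrite !add0r mul1r oppr0 addr0.
Qed.

(** [to_matmodel] factors through [A1FF] and sends the product to a matrix with corner [varB * f];
    [varB] cancels in the domain of power series. *)
Lemma A1FF_lie_eval2_inj (f : pseries2) :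
  let a := \pi_A1FF chord_a in let b := \pi_A1FF chord_b in
  lie a b * eval2 f a b = 0 -> f = 0.
Proof.
move=> a b; have pi_morph := pi_A1FF_morphism.
rewrite -(filtered_morphism_eval2 pi_morph _ (t_fil _ _) (t_fil _ _)).
rewrite -(filtered_morphism_lie pi_morph) -piM -pi0.
have phi_morph := to_matmodel_morphism.
move/(A1FF_factor phi_morph matmodel_mulr_lie).
rewrite to_matmodel_lie_eval2 (filtered_morphism0 phi_morph).
move/(congr1 corner)=> Bf0; apply: (mulfI varB_neq0).
by rewrite mulr0; apply: Bf0.
Qed.


(** * Clearing denominators in the equation for lambda *)

(** Here [x] and [y] stand for [expq (a + b)] and [expq a]. Multiplying the first hypothesis by
    [a * (a + b)] turns these quotients into exponentials. *)
Lemma bch_identity (R : comNzRingType) (a b x y ea eb eab q : R) :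
  b * q = x - y * eb -> ea = 1 + a * y -> eab = 1 + (a + b) * x ->
  eab = ea * eb -> a * b * (a + b) * q = (a + b) * eb - a - b * eab.
Proof.
move=> bq eaE eabE eabM.
have -> : a * b * (a + b) * q = a * (a + b) * (b * q) by ring.
have -> : a * (a + b) * (b * q) = a * ((a + b) * x) - (a + b) * (a * y) * eb.
  by rewrite bq; ring.
have -> : (a + b) * x = eab - 1 by rewrite eabE; ring.
have -> : a * y = ea - 1 by rewrite eaE; ring.
by rewrite eabM; ring.
Qed.

Lemma add_div3 (F : fieldType) (a b c u v : F) :
  a != 0 -> b != 0 -> c != 0 ->
  1 / (a * b) + u / (b * c) + v / (a * c) = (c + a * u + b * v) / (a * b * c).
Proof. by move=> a0 b0 c0; field; rewrite a0 b0 c0. Qed.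

Lemma fraction_eqE (R : idomainType) (a b c x u v : R) :
  a != 0 -> b != 0 -> c != 0 ->
  x%:F = 1 / (a * b)%:F + u%:F / (b * c)%:F + v%:F / (a * c)%:F
    :> {fraction R} <->
  a * b * c * x = c + a * u + b * v.
Proof.
move=> a0 b0 c0.
have F0 (y : R) : y != 0 -> (y%:F : {fraction R}) != 0.
  by rewrite tofrac_eq0.
have abcF : (a * b * c)%:F != 0 :> {fraction R} by rewrite F0 // !mulf_neq0.
have -> : 1 / (a * b)%:F + u%:F / (b * c)%:F + v%:F / (a * c)%:F
    = (c + a * u + b * v)%:F / (a * b * c)%:F :> {fraction R}.
  rewrite (tofracD (c + a * u)) (tofracD c) (tofracM (a * b)) (tofracM a b).
  rewrite (tofracM b c) (tofracM a c) (tofracM a u) (tofracM b v).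
  by apply: add_div3; apply: F0.
split=> [/(canLR (divfK abcF))|<-].
  rewrite -tofracM => /eqP; rewrite tofrac_eq => /eqP <-.
  exact: mulrC.
by rewrite tofracM mulrC mulKf.
Qed.

(** Here [na] and [nb] stand for [exp (- a)] and [exp (- b)]. Multiply by the nonzero
    [ea * (a * b * c)] and use [ea * eb * ec = 1] and [ea * ec = nb]. *)
Lemma clear_denom_eqE (R : idomainType) (a b c ea na eb nb ec T l1 l2 l3 : R) :
  a != 0 -> b != 0 -> c != 0 -> ea * na = 1 -> eb * ec = na -> ea * ec = nb ->
  a * b * c * T = a * ec + b + c * na ->
  T - (l1 * eb * ec + l2 * ec + l3) = 0 <->
  a * b * c * (l1 + nb * l2 + ea * l3) = c + a * nb + b * ea.
Proof.
move=> a0 b0 c0 ea1 ebc eac TE.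
have -> : c + a * nb + b * ea = ea * (a * b * c * T).
  by rewrite TE -eac -[c in LHS]mul1r -ea1; ring.
have -> : a * b * c * (l1 + nb * l2 + ea * l3)
    = ea * (a * b * c * (l1 * eb * ec + l2 * ec + l3)).
  by rewrite -(mulrA l1) ebc -eac -[l1 in LHS]mulr1 -ea1; ring.
have ea0 : ea != 0.
  by apply: contra_eq_neq ea1 => ->; rewrite mul0r eq_sym oner_eq0.
have abc0 : a * b * c != 0 by rewrite !mulf_neq0.
split=> [/eqP|/(mulfI ea0)/(mulfI abc0) ->]; last by rewrite subrr.
by rewrite subr_eq0 => /eqP ->.
Qed.

Section LambdaEquation.
Let a : pseries2 := varA.
Let b : pseries2 := varB.
Let c : pseries2 := - (a + b).

Let fa : fil 1 a := varA_fil.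
Let fb : fil 1 b := varB_fil.
Let fc : fil 1 c. Proof. by apply: filN; apply: filD. Qed.

Lemma bch_quot_clear_denom :
  a * b * (a + b) * bch_quot = (a + b) * exp b - a - b * exp (a + b).
Proof.
have fab : fil 1 (a + b) := varAB_fil.
apply: (@bch_identity _ a b (expq (a + b)) (expq a) (exp a)).
- exact/esym/bch_quot_varB.
- exact: exp_expq.
- exact: exp_expq.
- exact: (expD fa fb (mulrC _ _)).
Qed.

(** Substitute [b], [c] for the two variables in [bch_quot_clear_denom], use [b + c = - a] and
    change signs. In a commutative ring [acts_as] with [u = 1] expresses that the substitution is
    multiplicative, so it can be made factor by factor. *)
Lemma bch_quot_bc : let T := eval2 bch_quot b c in
  a * b * c * T = a * exp c + b + c * exp (- a).
Proof.
move=> T; have bc : b + c = - a by rewrite /c opprD addrCA subrr addr0.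
have actb : acts_as 1 b c b varA.
  by apply: acts_as_varA => // w; rewrite -!mulrA (mulrC b).
have actc : acts_as 1 b c c varB by apply: acts_as_varB.
have actT : acts_as 1 b c T bch_quot.
  by rewrite -[X in acts_as _ _ _ _ X]eval2_var; apply: acts_as_eval2.
have actbc : acts_as 1 b c (b + c) (a + b) := acts_asD fb fc actb actc.
have act1 : acts_as 1 b c (b * c * (b + c) * T) (a * b * (a + b) * bch_quot).
  exact: (acts_asM (acts_asM (acts_asM actb actc) actbc) actT).
have fab : fil 1 (a + b) := varAB_fil.
have fbc : fil 1 (b + c) := filD fb fc.
have actec := acts_as_exp fb fc fc fb actc.
have actebc := acts_as_exp fb fc fbc fab actbc.
have act2 : acts_as 1 b c ((b + c) * exp c - b - c * exp (b + c))
    ((a + b) * exp b - a - b * exp (a + b)).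
  exact: (acts_asB fb fc (acts_asB fb fc (acts_asM actbc actec) actb)
    (acts_asM actc actebc)).
have := acts_asE act1; rewrite bch_quot_clear_denom -(acts_asE act2) !mul1r bc.
move/(congr1 -%R) => E.
have negl (p q r s : pseries2) : p * q * r * s = - (q * r * - p * s) by ring.
have negr (p q r x y : pseries2) : - (- p * x - q - r * y) = p * x + q + r * y.
  by ring.
by rewrite negl E negr.
Qed.

Lemma hexagon_defect_eq0 (lam : pseries2) :
  (forall i j, lam i j = lam j i) ->
  hexagon_defect lam = 0 <->
  (eval2 lam a b + exp (- b) * eval2 lam b c + exp a * eval2 lam a c)%:F
    = 1 / (a * b)%:F + (exp (- b))%:F / (b * c)%:F + (exp a)%:F / (a * c)%:F
        :> {fraction pseries2}.
Proof.
move=> lam_sym; rewrite /hexagon_defect -/a -/b -/c.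
have fna : fil 1 (- a) by apply: filN.
have fnb : fil 1 (- b) by apply: filN.
(* The hexagon produces lambda at [(c, b)] and [(c, a)]; symmetry of [lam] brings the arguments into
   the order of the equation. *)
rewrite eval2_var (eval2C fc fb (mulrC _ _) lam_sym).
rewrite (eval2C fc fa (mulrC _ _) lam_sym).
set T := eval2 bch_quot b c; set L2 := eval2 lam b c; set L3 := eval2 lam a c.
have a0 : a != 0.
  by apply/eqP => /(congr1 (fun f : pseries2 => f 1%N 0%N)).
have b0 : b != 0 := varB_neq0.
have c0 : c != 0.
  rewrite oppr_eq0; apply/eqP => /(congr1 (fun f : pseries2 => f 1%N 0%N)) /=.
  by rewrite /a /b /=.
have ea1 : exp a * exp (- a) = 1.
  by rewrite -(expD fa fna (mulrC _ _)) subrr exp0.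
have ebc : exp b * exp c = exp (- a).
  by rewrite -(expD fb fc (mulrC _ _)) /c opprD addrCA subrr addr0.
have eab : exp a * exp c = exp (- b).
  rewrite -(expD fa fc (mulrC a c)); congr exp; rewrite /c opprD.
  exact: (addNKr a).
have abc0 : a * b * c != 0 by rewrite !mulf_neq0.
rewrite (fraction_eqE _ _ _ a0 b0 c0).
exact: (clear_denom_eqE _ _ _ a0 b0 c0 ea1 ebc eab bch_quot_bc).
Qed.

End LambdaEquation.

(** * The two sides of the hexagon in [A1FF] *)

Lemma pi_t_fil (i j : 'I_3) : fil 1 (\pi_A1FF (t i j)).
Proof. by exists (t i j) => //; apply: t_fil. Qed.

Lemma pi_lie0_opp (i j k : 'I_3) : uniq [:: i; j; k] ->
  lie (\pi_A1FF (t i k)) (\pi_A1FF (t j k))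
  = lie (\pi_A1FF (t i j)) (\pi_A1FF (t i k)).
Proof.
move=> hu; apply: lie0_opp.
rewrite -piD -(filtered_morphism_lie pi_A1FF_morphism).
by rewrite t_4T // (filtered_morphism0 pi_A1FF_morphism).
Qed.

Lemma on_strands_pi_morphism (s : 3.-tuple 'I_3) : uniq s ->
  filtered_morphism (fun x : Ahat 3 => \pi_A1FF (on_strands s x)).
Proof.
move=> us; apply: (filtered_morphism_comp pi_A1FF_morphism).
exact/filtered_morphism_Ahat/on_strands_compat.
Qed.

(** A relabeling followed by the projection factors through [A1FF], so [Phi] may be replaced by its
    normal form before relabeling. *)
Lemma on_strands_lamE (Phi : Ahat 3) (lam : pseries2) (s : 3.-tuple 'I_3) :
  uniq s ->
  Phi = 1 + lie chord_a chord_b * eval2 lam chord_a chord_b %[mod A1FF] ->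
  let x := \pi_A1FF (t (tnth s s1) (tnth s s2)) in
  let y := \pi_A1FF (t (tnth s s2) (tnth s s3)) in
  \pi_A1FF (on_strands s Phi) = 1 + lie x y * eval2 lam x y.
Proof.
move=> us lamE /=; have phi_morph := on_strands_pi_morphism us.
apply: etrans (A1FF_factor phi_morph A1FF_mulr_lie lamE) _.
apply: etrans (filtered_morphism_add1_lie phi_morph _ (t_fil _ _) (t_fil _ _)) _.
by rewrite /on_strands !Ahat_map_t; try exact: on_strands_compat.
Qed.

Lemma on_strands_exp (s : 2.-tuple 'I_3) : uniq s ->
  \pi_A1FF (on_strands s (exp t12))
  = exp (\pi_A1FF (t (tnth s ord0) (tnth s ord_max))).
Proof.
move=> us; have s_morph := filtered_morphism_Ahat (on_strands_compat us).
have pis_morph := filtered_morphism_comp pi_A1FF_morphism s_morph.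
apply: etrans (filtered_morphism_exp pis_morph (t_fil _ _)) _.
by rewrite /= Ahat_map_t //; apply: on_strands_compat.
Qed.

Lemma Delta1_exp :
  \pi_A1FF (Delta1 (exp t12)) = exp (\pi_A1FF (t s2 s3) + \pi_A1FF (t s1 s3)).
Proof.
have D_morph := filtered_morphism_Ahat Delta1_compat.
have piD_morph := filtered_morphism_comp pi_A1FF_morphism D_morph.
apply: etrans (filtered_morphism_exp piD_morph (t_fil _ _)) _.
rewrite /= Ahat_map_t; last exact: Delta1_compat.
by rewrite -piD addrC.
Qed.

Lemma mulr_1sub_eq1 (A : pzRingType) (x y : A) :
  y * (1 - x) = 1 -> x * x = 0 -> y = 1 + x.
Proof.
move=> E xx; have <- : y * ((1 - x) * (1 + x)) = 1 + x.
  by rewrite mulrA E mul1r.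
by rewrite mulrDr mulr1 mulrBl mul1r xx subr0 subrK mulr1.
Qed.

Lemma unit_modA1FF (Phi x : Ahat 3) : fil 1 x -> Phi = 1 + x %[mod A1FF] ->
  Phi \is a GRing.unit.
Proof.
move=> fx /cquot_eqP /closed_ideal_fil1 f; apply: unit_fil.
by rewrite -(subrK x (Phi - 1)); apply: filD; rewrite // -addrA -opprD.
Qed.

Theorem theorem1 (Phi : Ahat 3) (lam : pseries2)
    (symmetry : Phi * on_strands [tuple s3; s2; s1] Phi = 1)
    (nondegeneracy : forall i : 'I_3, eta i Phi = 1)
    (grouplike : exists2 phi : Ahat 3, Lhat phi & Phi = exp phi)
    (lam_sym : forall i j : nat, lam i j = lam j i)
    (lamE : Phi = 1 + lie chord_a chord_b * eval2 lam chord_a chord_b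
             %[mod A1FF]) :
  let R : Ahat 2 := exp t12 in
  let hexagon :=
    Delta1 R = Phi * on_strands [tuple s2; s3] R
                 * on_strands [tuple s1; s3; s2] (Phi^-1)
                 * on_strands [tuple s1; s3] R
                 * on_strands [tuple s3; s1; s2] Phi %[mod A1FF] in
  let a : pseries2 := varA in
  let b : pseries2 := varB in
  let c : pseries2 := - (a + b) in
  let lambda_equation :=
    (eval2 lam a b + exp (- b) * eval2 lam b c + exp a * eval2 lam a c)%:F
      = 1 / (a * b)%:F + (exp (- b))%:F / (b * c)%:F + (exp a)%:F / (a * c)%:F
        :> {fraction pseries2} in
  hexagon <-> lambda_equation.
Proof.
move=> R hexagon a b c lambda_equation.
(* It remains to show that the hexagon holds exactly when [hexagon_defect lam] vanishes. *)
apply: iff_trans (hexagon_defect_eq0 lam_sym); rewrite {}/hexagon {}/R.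
clear lambda_equation a b c.
pose a := \pi_A1FF (t s1 s2); pose b := \pi_A1FF (t s2 s3).
pose c := \pi_A1FF (t s1 s3).
have fa : fil 1 a := pi_t_fil _ _; have fb : fil 1 b := pi_t_fil _ _.
have fc : fil 1 c := pi_t_fil _ _; have fk : fil 1 (lie a b) := fil_lie b fa.
(* This equality and the next are 4T for the strand orders 2, 1, 3 and 1, 3, 2. *)
have lie_bc : lie b c = lie a b.
  by have := @pi_lie0_opp s2 s1 s3 isT; rewrite (t_sym s2 s1).
have lie_ca : lie c a = lie a b.
  have := @pi_lie0_opp s1 s3 s2 isT; rewrite -/a -/c (t_sym s3 s2) -/b.
  by rewrite lieC => <-; rewrite lieC.
have PhiE : \pi_A1FF Phi = 1 + lie a b * eval2 lam a b.
  rewrite lamE; have pi_morph := pi_A1FF_morphism.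
  exact: (filtered_morphism_add1_lie pi_morph _ (t_fil _ _) (t_fil _ _)).
have Phi_unit : Phi \is a GRing.unit.
  by apply: unit_modA1FF lamE; apply/filMr/fil_lie/t_fil.
have Phi312 : \pi_A1FF (on_strands [tuple s3; s1; s2] Phi)
    = 1 + lie a b * eval2 lam c a.
  have := @on_strands_lamE Phi lam [tuple s3; s1; s2] isT lamE.
  rewrite -[tnth _ s1]/s3 -[tnth _ s2]/s1 -[tnth _ s3]/s2 (t_sym s3) -/a -/c /=.
  by rewrite lie_ca.
have Phi132 : \pi_A1FF (on_strands [tuple s1; s3; s2] Phi)
    = 1 - lie a b * eval2 lam c b.
  have := @on_strands_lamE Phi lam [tuple s1; s3; s2] isT lamE.
  rewrite -[tnth _ s1]/s1 -[tnth _ s2]/s3 -[tnth _ s3]/s2 (t_sym s3) -/b -/c /=.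
  by rewrite (lieC c) lie_bc mulNr.
(* The relabeled [Phi] is [1 - x] with [x * x = 0], as [x] begins with a commutator and has positive
   degree; its inverse is therefore [1 + x]. *)
have Phi132V : \pi_A1FF (on_strands [tuple s1; s3; s2] Phi^-1)
    = 1 + lie a b * eval2 lam c b.
  apply: mulr_1sub_eq1.
    have pis_morph := @on_strands_pi_morphism [tuple s1; s3; s2] isT.
    rewrite -Phi132.
    exact: (filtered_morphism_mulVr pis_morph Phi_unit).
  by rewrite mulrA (A1FF_mulr_lie a b (filMr _ fk)) mul0r.
have RHS : \pi_A1FF (Phi * on_strands [tuple s2; s3] (exp t12)
    * on_strands [tuple s1; s3; s2] Phi^-1 * on_strands [tuple s1; s3] (exp t12)
    * on_strands [tuple s3; s1; s2] Phi)
  = (1 + lie a b * eval2 lam a b) * exp b * (1 + lie a b * eval2 lam c b)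
    * exp c * (1 + lie a b * eval2 lam c a).
  rewrite 4!piM PhiE Phi132V Phi312.
  rewrite (@on_strands_exp [tuple s2; s3] isT).
  by rewrite (@on_strands_exp [tuple s1; s3] isT).
rewrite RHS Delta1_exp -/b -/c.
(* The two sides differ by [lie a b] times the evaluated defect. Injectivity gives the first
   direction, evaluation of the zero series the other. *)
have defectE := hexagon_defectE A1FF_mulr_lie fa fb fc lie_bc lie_ca lam.
split=> [E|defect0].
  by apply: A1FF_lie_eval2_inj; rewrite -defectE E subrr.
apply/eqP; rewrite -subr_eq0 defectE defect0.
by have := eval2Z fa fb 0 0; rewrite !scale0r => ->; rewrite mulr0.
Qed.
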